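(* Let $\nu>-1$ and let $d_\nu(z)=(1-\nu)J_\nu(z)+zJ_\nu'(z)$. Let $0<\alpha_{\nu,1}<\alpha_{\nu,2}<\cdots$ denote the positive zeros of $d_\nu$. Then $$d_\nu(z)=\frac{z^\nu}{2^\nu\Gamma(\nu+1)}\prod_{n\geq1}\left(1-\frac{z^2}{\alpha_{\nu,n}^2}\right),$$ where the infinite product converges uniformly on every compact subset of $\mathbb{C}$ (and $z^\nu$ denotes the principal branch).
   Context: $J_\nu$ denotes the Bessel function of the first kind of order $\nu$, $J_\nu(z)=\sum_{n\ge0}\frac{(-1)^n z^{2n+\nu}}{2^{2n+\nu}n!\,\Gamma(n+\nu+1)}$. The function $d_\nu(z)=(1-\nu)J_\nu(z)+zJ_\nu'(z)$ is called a Dini function; $\alpha_{\nu,n}$ denotes its $n$th positive zero. *)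

(* Defs.v *)
From Stdlib Require Import Arith Reals Lra List ClassicalEpsilon.
Open Scope R_scope.

Definition Cx : Type := (R * R)%type.
Definition RtoC (x : R) : Cx := (x, 0).
Definition C0 : Cx := (0, 0).
Definition C1 : Cx := (1, 0).
Definition Cadd (z w : Cx) : Cx := (fst z + fst w, snd z + snd w).
Definition Copp (z : Cx) : Cx := (- fst z, - snd z).
Definition Csub (z w : Cx) : Cx := Cadd z (Copp w).
Definition Cmul (z w : Cx) : Cx :=
  (fst z * fst w - snd z * snd w, fst z * snd w + snd z * fst w).
Definition Cinv (z : Cx) : Cx :=
  (fst z / (fst z ^ 2 + snd z ^ 2), - snd z / (fst z ^ 2 + snd z ^ 2)).
Definition Cdiv (z w : Cx) : Cx := Cmul z (Cinv w).
Definition Cnorm (z : Cx) : R := sqrt (fst z ^ 2 + snd z ^ 2).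

(* principal argument, in (-PI, PI] (0 at the origin) *)
Definition Carg (z : Cx) : R :=
  let x := fst z in let y := snd z in
  if Rlt_dec 0 x then atan (y / x)
  else if Rlt_dec x 0 then
    (if Rle_dec 0 y then atan (y / x) + PI else atan (y / x) - PI)
  else if Rlt_dec 0 y then PI / 2
  else if Rlt_dec y 0 then - (PI / 2) else 0.

(* principal branch of z^a for real a; convention 0^0 = 1, 0^a = 0 otherwise *)
Definition cpow (z : Cx) (a : R) : Cx :=
  if Req_EM_T (fst z) 0 then
    (if Req_EM_T (snd z) 0 then (if Req_EM_T a 0 then C1 else C0)
     else (exp (a * ln (Cnorm z)) * cos (a * Carg z),
           exp (a * ln (Cnorm z)) * sin (a * Carg z)))
  else (exp (a * ln (Cnorm z)) * cos (a * Carg z),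
        exp (a * ln (Cnorm z)) * sin (a * Carg z)).

Fixpoint Cpartial (f : nat -> Cx) (N : nat) : Cx :=
  match N with
  | O => C0
  | S k => Cadd (Cpartial f k) (f k)
  end.

Definition Cseries_lim (f : nat -> Cx) (l : Cx) : Prop :=
  forall eps, eps > 0 -> exists N0 : nat, forall N : nat, (N >= N0)%nat ->
    Cnorm (Csub (Cpartial f N) l) < eps.

Definition Csum (f : nat -> Cx) : Cx := epsilon (inhabits C0) (Cseries_lim f).

(* ---------- Gamma function (Euler/Gauss limit), for x not in {0,-1,-2,...} ---------- *)
Definition Gamma (x : R) : R :=
  epsilon (inhabits 0)
    (Un_cv (fun n => INR (fact n) * Rpower (INR n) x
                     / prod_f_R0 (fun k => x + INR k) n)).

Definition BesselJ (nu : R) (z : Cx) : Cx :=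
  Csum (fun n => Cmul
    (RtoC ((-1) ^ n / (Rpower 2 (2 * INR n + nu) * INR (fact n)
                        * Gamma (INR n + nu + 1))))
    (cpow z (2 * INR n + nu))).

(* J_nu'(z): the termwise derivative of the defining series *)
Definition BesselJ' (nu : R) (z : Cx) : Cx :=
  Csum (fun n => Cmul
    (RtoC ((-1) ^ n * (2 * INR n + nu)
           / (Rpower 2 (2 * INR n + nu) * INR (fact n) * Gamma (INR n + nu + 1))))
    (cpow z (2 * INR n + nu - 1))).

Definition dini (nu : R) (z : Cx) : Cx :=
  Cadd (Cmul (RtoC (1 - nu)) (BesselJ nu z)) (Cmul z (BesselJ' nu z)).

(* prod_{n < N} (1 - z^2 / alpha_n^2) ; alpha 0 is the first zero alpha_{nu,1} *)
Fixpoint dini_pprod (alpha : nat -> R) (z : Cx) (N : nat) : Cx :=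
  match N with
  | O => C1
  | S k => Cmul (dini_pprod alpha z k)
                (Csub C1 (Cdiv (Cmul z z) (RtoC (alpha k ^ 2))))
  end.

Definition Copen (U : Cx -> Prop) : Prop :=
  forall z, U z -> exists r, r > 0 /\ forall w, Cnorm (Csub w z) < r -> U w.

Definition Ccompact (K : Cx -> Prop) : Prop :=
  forall (I : Type) (U : I -> Cx -> Prop),
    (forall i, Copen (U i)) ->
    (forall z, K z -> exists i, U i z) ->
    exists l : list I, forall z, K z -> exists i, In i l /\ U i z.

Definition unif_cv_on (K : Cx -> Prop) (F : nat -> Cx -> Cx) (P : Cx -> Cx) : Prop :=
  forall eps, eps > 0 -> exists N0 : nat, forall N : nat, (N >= N0)%nat ->
    forall z, K z -> Cnorm (Csub (F N z) (P z)) < eps.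

(* Main.v *)
(** The Dini function is [z^nu / (2^nu Gamma(nu+1))] times [F(z^2)], where
    [F(w) = sum_n (2n+1) (-w/4)^n / (n! (nu+1)_n)]. Replacing [1/n!] by [binomial(N,n) / N^n] gives
    the polynomials [P_N = q + 2 w q'] with [q] a rescaled Laguerre polynomial. By sign changes
    [q], hence [P_N], has [N] simple positive zeros, so [P_N(w) = prod_i (1 - w s_{N,i})] with
    [s_{N,i}] positive. Since [P_N(-t) <= F(-t) <= C exp(eps t)] for every [eps > 0], the tails of
    [sum_i s_{N,i}] are small uniformly in [N]; a cluster point [x] of the sequences [s_N] therefore
    satisfies [F(w) = prod_i (1 - w x_i)] locally uniformly, with no exponential factor. Finally the
    zeros of [F] are simple by Lommel's integral, so the [x_i] are exactly the [1 / alpha_i^2]. *)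

From Coquelicot Require Import Coquelicot.
From Stdlib Require Import Arith Reals Lra Lia List ClassicalEpsilon.
Open Scope R_scope.

(** * Polynomials with positive simple zeros *)

(** With [w = z^2], [z (z^nu f(w))' = z^nu (nu f + 2 w f')], so [(1 - nu) J + z J'] turns the series
    [f] of [J_nu] into [f + 2 w f']; this is the source of the factor [2n + 1] and of [q + 2 w q'].
    The obstacle is the passage to the limit. Polynomials with positive zeros may converge to a
    function with an extra factor [exp(-b w)]: in [(1 - w/N)^N] every zero escapes to infinity, yet
    together they leave an exponential. Bounding the sums of the inverse zeros does not exclude
    this; bounding the tails uniformly does. On the negative axis all factors are at least 1, so a
    growth bound there controls sums of inverse zeros directly, without contour integrals or zero
    counting. In terms of inverses, a zero lost at infinity becomes the harmless value 0 in a
    compact interval. Simplicity is needed because the limiting product repeats multiple zeros,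
    whereas [alpha] lists each zero once. *)

Fixpoint csum (a : nat -> R) (n : nat) (z : Complex.C) : Complex.C :=
  match n with
  | O => 0%C
  | S k => (csum a k z + a k * z ^ k)%C
  end.

Fixpoint rsum (a : nat -> R) (n : nat) (x : R) : R :=
  match n with
  | O => 0
  | S k => rsum a k x + a k * x ^ k
  end.

(* The zeros are stored through their inverses [s i]. *)
Fixpoint cprod (s : nat -> R) (n : nat) (z : Complex.C) : Complex.C :=
  match n with
  | O => 1%C
  | S k => (cprod s k z * (1 - z * s k))%C
  end.

Fixpoint rprod (s : nat -> R) (n : nat) (x : R) : R :=
  match n with
  | O => 1
  | S k => rprod s k x * (1 - x * s k)
  end.

Lemma RtoC_inj (x y : R) : RtoC x = RtoC y -> x = y.
Proof. intros h; exact (f_equal fst h). Qed.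

Lemma csum_RtoC (a : nat -> R) (n : nat) (x : R) : csum a n (RtoC x) = RtoC (rsum a n x).
Proof.
  induction n as [|n IH]; simpl; [reflexivity|].
  now rewrite IH, RtoC_plus, RtoC_mult, RtoC_pow.
Qed.

Lemma cprod_RtoC (s : nat -> R) (n : nat) (x : R) : cprod s n (RtoC x) = RtoC (rprod s n x).
Proof.
  induction n as [|n IH]; simpl; [reflexivity|].
  now rewrite IH, RtoC_mult, RtoC_minus, RtoC_mult.
Qed.

Lemma csum_shift (a : nat -> R) (n : nat) (z : Complex.C) :
  csum a (S n) z = (a O + z * csum (fun k => a (S k)) n z)%C.
Proof.
  induction n as [|n IH]; [simpl; ring|].
  change (csum a (S (S n)) z) with (csum a (S n) z + a (S n) * z ^ (S n))%C.
  rewrite IH; simpl; ring.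
Qed.

Lemma rsum_shift (a : nat -> R) (n : nat) (x : R) :
  rsum a (S n) x = a O + x * rsum (fun k => a (S k)) n x.
Proof.
  induction n as [|n IH]; [simpl; ring|].
  change (rsum a (S (S n)) x) with (rsum a (S n) x + a (S n) * x ^ (S n)).
  rewrite IH; simpl; ring.
Qed.

Lemma csum_ext (a b : nat -> R) (n : nat) (z : Complex.C) :
  (forall k, (k < n)%nat -> a k = b k) -> csum a n z = csum b n z.
Proof.
  intros h; induction n as [|n IH]; simpl; [reflexivity|].
  rewrite IH, (h n); auto.
Qed.

(** Synthetic division by [z - r]: the quotient starts with the value at [r] of the shifted
    polynomial, and the remainder is the value at [r]. *)
Lemma csum_divide (n : nat) : forall (a : nat -> R) (r : R), exists d : nat -> R,
  forall z : Complex.C, csum a (S n) z = ((z - r) * csum d n z + rsum a (S n) r)%C.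
Proof.
  induction n as [|n IH]; intros a r.
  - exists (fun _ => 0); intros z; simpl.
    rewrite RtoC_plus, RtoC_mult; ring.
  - destruct (IH (fun k => a (S k)) r) as [d hd].
    exists (fun k => match k with O => rsum (fun k => a (S k)) (S n) r | S j => d j end).
    intros z.
    rewrite csum_shift, hd, (rsum_shift a (S n) r), RtoC_plus, RtoC_mult.
    rewrite csum_shift; cbv beta iota.
    change (csum (fun k => d k) n z) with (csum d n z); ring.
Qed.

Lemma csum_factor (n : nat) : forall (a r : nat -> R),
  (forall k, (k < n)%nat -> r k <> 0) ->
  (forall j k, (j < k < n)%nat -> r j <> r k) ->
  (forall k, (k < n)%nat -> rsum a (S n) (r k) = 0) ->
  exists c : R, forall z, csum a (S n) z = (c * cprod (fun k => (/ r k)%R) n z)%C.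
Proof.
  induction n as [|n IH]; intros a r hnz hd h0.
  - exists (a O); intros z; simpl; ring.
  - destruct (csum_divide (S n) a (r n)) as [d hdiv].
    rewrite h0 in hdiv by lia.
    destruct (IH d r) as [c hc].
    + intros; apply hnz; lia.
    + intros; apply hd; lia.
    + intros k hk; specialize (hdiv (RtoC (r k))).
      rewrite !csum_RtoC, h0 in hdiv by lia.
      rewrite <- RtoC_minus, <- RtoC_mult, <- RtoC_plus in hdiv.
      apply RtoC_inj in hdiv.
      assert (r k - r n <> 0) by (specialize (hd k n ltac:(lia)); lra).
      apply Rmult_eq_reg_l with (r k - r n); lra.
    (* From [z - r = - r (1 - z / r)]. *)
    + exists (- (c * r n)); intros z.
      rewrite hdiv, hc; simpl.
      assert (hr : RtoC (r n) <> 0%C)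
        by (intros h; apply RtoC_inj in h; apply (hnz n); auto).
      rewrite RtoC_opp, RtoC_mult, RtoC_inv by (apply hnz; lia).
      field; exact hr.
Qed.

(** * Real-rootedness from sign changes *)

Definition decreasing_below (n : nat) (s : nat -> R) : Prop :=
  (forall k, (k < n)%nat -> 0 < s k) /\ (forall j k, (j < k < n)%nat -> s k < s j).

(** Besides simple positive zeros this encodes the normalisation [a O = 1], since the product is 1
    at 0. The identity is required at complex points, although the zeros are found on the real
    line. *)
Definition real_rooted (a : nat -> R) (n : nat) : Prop :=
  exists s, decreasing_below n s /\ forall z, csum a (S n) z = cprod s n z.

(** The Euler operator [x d/dx] keeps the index of each coefficient, and it is the only form of the
    derivative in the recurrence and in [dlag]. *)
Lemma is_derive_rsum (a : nat -> R) (n : nat) (x : R) : exists d,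
  is_derive (rsum a n) x d /\ x * d = rsum (fun k => INR k * a k) n x.
Proof.
  induction n as [|n (d & hd & e)].
  - exists 0; split; [exact (is_derive_const (V := R_NormedModule) 0 x) | simpl; ring].
  - exists (d + a n * (INR n * x ^ pred n)); split.
    + simpl; apply (is_derive_plus (V := R_NormedModule) (rsum a n) (fun y => a n * y ^ n));
        [exact hd|].
      auto_derive; [auto|ring].
    + simpl; rewrite <- e; destruct n; [simpl; ring|].
      simpl pred; simpl pow; ring.
Qed.

Lemma continuity_rsum (a : nat -> R) (n : nat) : continuity (rsum a n).
Proof.
  intros x; destruct (is_derive_rsum a n x) as (d & h & _).
  apply derivable_continuous_pt; exists d; apply is_derive_Reals; exact h.
Qed.

Lemma minus1_pow_sqr (k : nat) : (-1) ^ k * (-1) ^ k = 1.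
Proof. rewrite <- Rpow_mult_distr; replace (-1 * -1) with 1 by ring; apply pow1. Qed.

Lemma increasing_chain (u : nat -> R) (n : nat) :
  (forall k, (k < n)%nat -> u k < u (S k)) -> forall k, (k <= n)%nat ->
  forall j, (j < k)%nat -> u j < u k.
Proof.
  intros h k; induction k as [|k IH]; intros hk j hj; [lia|].
  destruct (Nat.eq_dec j k) as [->|]; [apply h; lia|].
  apply Rlt_trans with (u k); [apply IH; lia | apply h; lia].
Qed.

(** The [n] sign changes produce [n] distinct zeros of a polynomial of degree at most [n], hence all
    of them. Starting at [u O = 0] makes them positive, and comparing values at 0 fixes the constant
    of the factorisation. *)
Lemma sign_changes_real_rooted (a u : nat -> R) (n : nat) :
  a O = 1 -> u O = 0 ->
  (forall k, (k < n)%nat -> u k < u (S k)) ->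
  (forall k, (k <= n)%nat -> 0 < (-1) ^ k * rsum a (S n) (u k)) ->
  real_rooted a n.
Proof.
  intros ha hu0 hinc hs.
  assert (hex : forall k, exists r, (k < n)%nat -> u k < r < u (S k) /\ rsum a (S n) r = 0).
  { intros k; destruct (Nat.lt_ge_cases k n) as [hk|hk]; [|exists 0; intros; lia].
    pose proof (hs k ltac:(lia)) as h1; pose proof (hs (S k) ltac:(lia)) as h2.
    simpl pow in h2.
    (* The factor orients the function from negative to positive, as [IVT] expects. *)
    assert (hc : continuity (fun x => - (-1) ^ k * rsum a (S n) x)).
    { intros x; apply continuity_pt_scal; apply continuity_rsum. }
    destruct (IVT _ (u k) (u (S k)) hc) as [r [hr h0]]; [now apply hinc|lra|lra|].
    exists r; intros _.
    assert (e : rsum a (S n) r = 0).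
    { pose proof (minus1_pow_sqr k) as m.
      transitivity ((-1) ^ k * ((-1) ^ k * rsum a (S n) r));
        [rewrite <- Rmult_assoc, m; ring|].
      replace ((-1) ^ k * rsum a (S n) r) with 0 by lra; ring. }
    split; [|exact e]; split.
    - destruct (Req_dec (u k) r) as [E|]; [|lra]; rewrite E, e in h1; lra.
    - destruct (Req_dec (u (S k)) r) as [E|]; [|lra]; rewrite E, e in h2; lra. }
  set (r := fun k => proj1_sig (constructive_indefinite_description _ (hex k))).
  assert (hr : forall k, (k < n)%nat -> u k < r k < u (S k) /\ rsum a (S n) (r k) = 0).
  { intros k; exact (proj2_sig (constructive_indefinite_description _ (hex k))). }
  pose proof (increasing_chain u n hinc) as hch.
  assert (hpos : forall k, (k < n)%nat -> 0 < r k).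
  { intros k hk; destruct (hr k hk) as [[h _] _].
    destruct k; [rewrite hu0 in h; exact h|].
    specialize (hch (S k) ltac:(lia) O ltac:(lia)); lra. }
  assert (hlt : forall j k, (j < k < n)%nat -> r j < r k).
  { intros j k hjk; destruct (hr j ltac:(lia)) as [[_ h1] _].
    destruct (hr k ltac:(lia)) as [[h2 _] _].
    destruct (Nat.eq_dec (S j) k) as [E|]; [rewrite E in h1; lra|].
    specialize (hch k ltac:(lia) (S j) ltac:(lia)); lra. }
  exists (fun k => / r k); split; [split|].
  - intros k hk; apply Rinv_0_lt_compat; auto.
  - intros j k hjk; apply Rinv_lt_contravar; [|auto].
    apply Rmult_lt_0_compat; apply hpos; lia.
  - destruct (csum_factor n a r) as [c hc].
    + intros k hk; specialize (hpos k hk); lra.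
    + intros j k hjk; specialize (hlt j k hjk); lra.
    + intros k hk; apply hr; exact hk.
    + intros z; rewrite hc.
      assert (e : c = 1); [|rewrite e; ring].
      specialize (hc (RtoC 0)); rewrite csum_RtoC, cprod_RtoC, <- RtoC_mult in hc.
      apply RtoC_inj in hc; rewrite rsum_shift, ha in hc.
      assert (h1 : forall m, rprod (fun k => / r k) m 0 = 1).
      { induction m as [|m IH]; simpl; [reflexivity|rewrite IH; ring]. }
      rewrite h1 in hc; lra.
Qed.

(** If the shifted polynomial is at least [c], then beyond [1 + |a_0| / c] the product with [x] is
    at least [c + |a_0|], which absorbs the constant term; the same [c] survives every step. *)
Lemma rsum_eventually_pos (n : nat) : forall a : nat -> R, 0 < a n ->
  exists c X, 0 < c /\ 0 < X /\ forall x, X <= x -> c <= rsum a (S n) x.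
Proof.
  induction n as [|n IH]; intros a ha.
  - exists (a O), 1; simpl; split; [auto|split; [lra|intros; lra]].
  - destruct (IH (fun k => a (S k)) ha) as (c & X & hc & hX & h).
    exists c, (Rmax X (1 + Rabs (a O) / c)); split; [auto|split].
    + apply Rlt_le_trans with X; [auto|apply Rmax_l].
    + intros x hx.
      assert (h1 : X <= x) by (eapply Rle_trans; [apply Rmax_l|exact hx]).
      assert (h2 : 1 + Rabs (a O) / c <= x) by (eapply Rle_trans; [apply Rmax_r|exact hx]).
      rewrite rsum_shift; specialize (h x h1).
      assert (x * c <= x * rsum (fun k => a (S k)) (S n) x)
        by (apply Rmult_le_compat_l; lra).
      assert ((1 + Rabs (a O) / c) * c <= x * c) by (apply Rmult_le_compat_r; lra).
      replace ((1 + Rabs (a O) / c) * c) with (c + Rabs (a O)) in * by (field; lra).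
      pose proof (Rle_abs (- a O)); rewrite Rabs_Ropp in *; lra.
Qed.

Lemma rprod_sign (s : nat -> R) (n : nat) (x : R) :
  (forall k, (k < n)%nat -> 1 < x * s k) -> 0 < (-1) ^ n * rprod s n x.
Proof.
  induction n as [|n IH]; intros h; simpl; [lra|].
  specialize (IH ltac:(auto)); specialize (h n ltac:(auto)).
  replace (-1 * (-1) ^ n * (rprod s n x * (1 - x * s n)))
    with ((-1) ^ n * rprod s n x * (x * s n - 1)) by ring.
  apply Rmult_lt_0_compat; lra.
Qed.

Lemma rprod_zero (s : nat -> R) (n k : nat) (x : R) :
  (k < n)%nat -> x * s k = 1 -> rprod s n x = 0.
Proof.
  intros hk e; induction n as [|n IH]; [lia|]; simpl.
  destruct (Nat.eq_dec k n) as [->|]; [rewrite e; ring | rewrite IH by lia; ring].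
Qed.

Lemma ex_derive_rprod (s : nat -> R) (n : nat) (x : R) : ex_derive (rprod s n) x.
Proof.
  induction n as [|n IH]; simpl; [exact (ex_derive_const (V := R_NormedModule) 1 x)|].
  apply (ex_derive_mult (rprod s n) (fun y => 1 - y * s n)); [exact IH|].
  auto_derive; auto.
Qed.

(** By the product rule with the last factor: at the last zero only the derivative of that factor
    contributes, while at an earlier zero [/ s k] the factor itself remains, and it is positive
    because [s n < s k]. *)
Lemma Derive_rprod_sign (s : nat -> R) (n : nat) : decreasing_below n s ->
  forall k, (k < n)%nat -> 0 < (-1) ^ S k * Derive (rprod s n) (/ s k).
Proof.
  induction n as [|n IH]; intros [hp hd] k hk; [lia|].
  assert (e : Derive (rprod s (S n)) (/ s k)
    = Derive (rprod s n) (/ s k) * (1 - / s k * s n) + rprod s n (/ s k) * (- s n)).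
  { simpl; rewrite (Derive_mult (rprod s n) (fun y => 1 - y * s n)).
    - f_equal; f_equal; apply is_derive_unique; auto_derive; [auto|ring].
    - apply ex_derive_rprod.
    - auto_derive; auto. }
  rewrite e; clear e.
  assert (hk0 : 0 < s k) by (apply hp; lia).
  destruct (Nat.eq_dec k n) as [->|hkn].
  - replace (/ s n * s n) with 1 by (field; lra).
    assert (hs : 0 < (-1) ^ n * rprod s n (/ s n)).
    { apply rprod_sign; intros j hj; specialize (hd j n ltac:(lia)).
      apply Rmult_lt_reg_l with (s n); [lra|].
      rewrite <- Rmult_assoc, Rinv_r by lra; lra. }
    simpl pow.
    replace (-1 * (-1) ^ n * (Derive (rprod s n) (/ s n) * (1 - 1)
      + rprod s n (/ s n) * - s n)) with ((-1) ^ n * rprod s n (/ s n) * s n) by ring.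
    apply Rmult_lt_0_compat; lra.
  - rewrite (rprod_zero s n k (/ s k)) by (try lia; field; lra).
    rewrite Rmult_0_l, Rplus_0_r, <- Rmult_assoc.
    apply Rmult_lt_0_compat.
    + apply IH; [split; intros; [apply hp | apply hd]; lia|lia].
    + specialize (hd k n ltac:(lia)).
      assert (/ s k * s n < 1); [|lra].
      apply Rmult_lt_reg_l with (s k); [lra|].
      rewrite <- Rmult_assoc, Rinv_r by lra; lra.
Qed.

(** * Laguerre polynomials *)

(** The rising factorial of [nu + 1], not of [nu]. *)
Fixpoint poch (nu : R) (n : nat) : R :=
  match n with
  | O => 1
  | S k => poch nu k * (nu + 1 + INR k)
  end.

Fixpoint fall (N n : nat) : R :=
  match n with
  | O => 1
  | S k => fall N k * (INR N - INR k)
  end.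

(** The Laguerre polynomial [L_N^(nu)] divided by its value at 0, that is [1F1(-N; nu+1; x)]. *)
Definition lag (nu : R) (N k : nat) : R := (-1) ^ k * fall N k / (INR (fact k) * poch nu k).

Definition dlag (nu : R) (N k : nat) : R := (2 * INR k + 1) * lag nu N k.

Lemma poch_pos (nu : R) (n : nat) : -1 < nu -> 0 < poch nu n.
Proof.
  intros h; induction n as [|n IH]; simpl; [lra|].
  pose proof (pos_INR n); apply Rmult_lt_0_compat; lra.
Qed.

Lemma fall_gt (N n : nat) : (N < n)%nat -> fall N n = 0.
Proof.
  induction n as [|n IH]; intros h; [lia|]; simpl.
  destruct (Nat.eq_dec N n) as [->|]; [ring|rewrite IH by lia; ring].
Qed.

Lemma fall_pos (N n : nat) : (n <= N)%nat -> 0 < fall N n.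
Proof.
  induction n as [|n IH]; intros h; simpl; [lra|].
  assert (INR n < INR N) by (apply lt_INR; lia).
  apply Rmult_lt_0_compat; [apply IH; lia|lra].
Qed.

Lemma fall_succ (N n : nat) : fall (S N) (S n) = (INR N + 1) * fall N n.
Proof.
  induction n as [|n IH]; [cbn [fall]; rewrite S_INR; simpl (INR 0); ring|].
  change (fall (S N) (S (S n))) with (fall (S N) (S n) * (INR (S N) - INR (S n))).
  rewrite IH, !S_INR; cbn [fall]; ring.
Qed.

Lemma lag_0 (nu : R) (N : nat) : lag nu N 0 = 1.
Proof. unfold lag; simpl; field. Qed.

(** Coefficients of [(N+1+nu) q_{N+1} = x q_N' + (N+1+nu-x) q_N]. Unlike the three-term recurrence
    it involves only [q_N] and its derivative, so the induction on zeros needs no interlacing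
    hypothesis. *)
Lemma lag_succ (nu : R) (N k : nat) : -1 < nu ->
  (INR N + 1 + nu) * lag nu (S N) (S k)
  = (INR (S k) + (INR N + 1 + nu)) * lag nu N (S k) - lag nu N k.
Proof.
  intros hnu; unfold lag; rewrite fall_succ.
  pose proof (poch_pos nu k hnu); pose proof (pos_INR k); pose proof (INR_fact_lt_0 k).
  rewrite fact_simpl, mult_INR, S_INR.
  simpl fall; simpl poch; simpl pow; field; repeat split; lra.
Qed.

Lemma rsum_lag_succ (nu : R) (N m : nat) (x : R) : -1 < nu ->
  (INR N + 1 + nu) * rsum (lag nu (S N)) (S m) x
  = rsum (fun k => INR k * lag nu N k) (S m) x
    + (INR N + 1 + nu) * rsum (lag nu N) (S m) x - x * rsum (lag nu N) m x.
Proof.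
  intros hnu; induction m as [|m IH]; [simpl; rewrite !lag_0; ring|].
  pose proof (lag_succ nu N m hnu) as e.
  change (rsum (lag nu (S N)) (S (S m)) x)
    with (rsum (lag nu (S N)) (S m) x + lag nu (S N) (S m) * x ^ S m).
  rewrite Rmult_plus_distr_l, IH, <- Rmult_assoc, e.
  change (rsum (fun k => INR k * lag nu N k) (S (S m)) x)
    with (rsum (fun k => INR k * lag nu N k) (S m) x + INR (S m) * lag nu N (S m) * x ^ S m).
  change (rsum (lag nu N) (S (S m)) x)
    with (rsum (lag nu N) (S m) x + lag nu N (S m) * x ^ S m).
  simpl rsum at 6; simpl pow; simpl rsum; ring.
Qed.

Lemma rsum_scal (c : R) (a : nat -> R) (n : nat) (x : R) :
  rsum (fun k => c * a k) n x = c * rsum a n x.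
Proof. induction n as [|n IH]; simpl; [ring|rewrite IH; ring]. Qed.

Lemma factored_root (a s : nat -> R) (n k : nat) :
  decreasing_below n s -> (forall z, csum a (S n) z = cprod s n z) -> (k < n)%nat ->
  rsum a (S n) (/ s k) = 0 /\
  0 < (-1) ^ S k * rsum (fun j => INR j * a j) (S n) (/ s k).
Proof.
  intros hs hf hk.
  assert (e : forall x, rsum a (S n) x = rprod s n x).
  { intros x; apply RtoC_inj; rewrite <- csum_RtoC, <- cprod_RtoC; apply hf. }
  assert (hp : 0 < s k) by (apply hs; exact hk).
  split.
  - rewrite e; apply rprod_zero with k; [exact hk|field; lra].
  - destruct (is_derive_rsum a (S n) (/ s k)) as (d & hd & <-).
    replace d with (Derive (rprod s n) (/ s k)).
    + pose proof (Derive_rprod_sign s n hs k hk).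
      replace ((-1) ^ S k * (/ s k * Derive (rprod s n) (/ s k)))
        with (/ s k * ((-1) ^ S k * Derive (rprod s n) (/ s k))) by ring.
      apply Rmult_lt_0_compat; [now apply Rinv_0_lt_compat|assumption].
    + rewrite <- (is_derive_unique _ _ _ hd); symmetry; apply Derive_ext; exact e.
Qed.

Lemma rsum_at_0 (a : nat -> R) (n : nat) : rsum a (S n) 0 = a O.
Proof. rewrite rsum_shift; ring. Qed.

(* At the zeros of the [N]-th polynomial only the derivative term of the recurrence survives, and
   it alternates in sign. *)
Lemma lag_real_rooted (nu : R) (N : nat) : -1 < nu -> real_rooted (lag nu N) N.
Proof.
  intros hnu; induction N as [|N (s & hs & hf)].
  - exists (fun _ => 0); split; [split; intros; lia|].
    intros z; simpl; rewrite lag_0; ring.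
  - pose proof (pos_INR N) as hN.
    (* The zeros of [q_N] and the origin give only [N + 1] sample points; the last one is taken far
       to the right, where the leading coefficient, of sign [(-1)^(N+1)], decides. *)
    destruct (rsum_eventually_pos (S N) (fun k => (-1) ^ S N * lag nu (S N) k))
      as (c & X0 & hc & hX0 & hX).
    { unfold lag; unfold Rdiv.
      replace ((-1) ^ S N * ((-1) ^ S N * fall (S N) (S N) * / (INR (fact (S N)) * poch nu (S N))))
        with (((-1) ^ S N * (-1) ^ S N) * (fall (S N) (S N) * / (INR (fact (S N)) * poch nu (S N))))
        by ring.
      rewrite minus1_pow_sqr, Rmult_1_l.
      apply Rmult_lt_0_compat; [apply fall_pos; lia|].
      apply Rinv_0_lt_compat, Rmult_lt_0_compat; [apply INR_fact_lt_0|now apply poch_pos]. }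
    (* For [N = 0] the second entry is an arbitrary number, and [X0 > 0] alone places [X] to the
       right of 0. *)
    set (X := Rmax X0 (1 + / s (N - 1)%nat)).
    assert (h1 : X0 <= X) by apply Rmax_l.
    assert (h2 : 1 + / s (N - 1)%nat <= X) by apply Rmax_r.
    apply sign_changes_real_rooted
      with (fun k => match k with O => 0 | S j => if Nat.ltb j N then / s j else X end).
    + apply lag_0.
    + reflexivity.
    + intros [|k] hk.
      * destruct (Nat.ltb_spec 0 N); [|lra].
        apply Rinv_0_lt_compat, hs; assumption.
      * destruct (Nat.ltb_spec k N); [|lia].
        destruct (Nat.ltb_spec (S k) N).
        -- apply Rinv_lt_contravar; [apply Rmult_lt_0_compat; apply hs; lia|apply hs; lia].
        -- replace k with (N - 1)%nat by lia; lra.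
    + intros [|k] hk; [rewrite rsum_at_0, lag_0; simpl; lra|].
      destruct (Nat.ltb_spec k N) as [hkN|hkN].
      * destruct (factored_root _ s N k hs hf hkN) as [e0 hpos].
        pose proof (rsum_lag_succ nu N (S N) (/ s k) hnu) as e.
        assert (ez : lag nu N (S N) = 0)
          by (unfold lag; rewrite fall_gt by lia; unfold Rdiv; ring).
        change (rsum (lag nu N) (S (S N)) (/ s k))
          with (rsum (lag nu N) (S N) (/ s k) + lag nu N (S N) * (/ s k) ^ S N) in e.
        change (rsum (fun k => INR k * lag nu N k) (S (S N)) (/ s k))
          with (rsum (fun k => INR k * lag nu N k) (S N) (/ s k)
                + INR (S N) * lag nu N (S N) * (/ s k) ^ S N) in e.
        rewrite ez, e0 in e.
        apply Rmult_lt_reg_l with (INR N + 1 + nu); [lra|].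
        replace ((INR N + 1 + nu) * ((-1) ^ S k * rsum (lag nu (S N)) (S (S N)) (/ s k)))
          with ((-1) ^ S k * ((INR N + 1 + nu) * rsum (lag nu (S N)) (S (S N)) (/ s k))) by ring.
        rewrite e; lra.
      * replace k with N by lia; rewrite <- rsum_scal.
        apply Rlt_le_trans with c; [exact hc|apply hX; exact h1].
Qed.

(** At the zeros of [q] the value of [q + 2 x q'] is [2 x q'], which alternates because these zeros
    are simple. Together with the value 1 at the origin this already gives [N + 1] alternating
    samples. *)
Lemma dlag_real_rooted (nu : R) (N : nat) : -1 < nu -> real_rooted (dlag nu N) N.
Proof.
  intros hnu; destruct (lag_real_rooted nu N hnu) as (s & hs & hf).
  apply sign_changes_real_rooted with (fun k => match k with O => 0 | S j => / s j end).
  - unfold dlag; rewrite lag_0; simpl; ring.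
  - reflexivity.
  - intros [|k] hk; [apply Rinv_0_lt_compat, hs; assumption|].
    apply Rinv_lt_contravar; [apply Rmult_lt_0_compat; apply hs; lia|apply hs; lia].
  - assert (e : forall m x, rsum (dlag nu N) m x
      = rsum (lag nu N) m x + 2 * rsum (fun k => INR k * lag nu N k) m x).
    { induction m as [|m IH]; intros x; simpl; [ring|rewrite IH; unfold dlag; ring]. }
    intros [|k] hk; [rewrite rsum_at_0; unfold dlag; rewrite lag_0; simpl; lra|].
    destruct (factored_root _ s N k hs hf ltac:(lia)) as [e0 hpos].
    rewrite e, e0; lra.
Qed.

Lemma real_rooted_scale (a : nat -> R) (n : nat) (t : R) : 0 < t ->
  real_rooted a n -> real_rooted (fun k => a k * t ^ k) n.
Proof.
  intros ht (s & [hp hd] & hf).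
  exists (fun k => t * s k); split; [split|].
  - intros k hk; apply Rmult_lt_0_compat; auto.
  - intros j k hjk; apply Rmult_lt_compat_l; auto.
  - assert (e1 : forall m z, csum (fun k => a k * t ^ k) m z = csum a m (t * z)%C).
    { induction m as [|m IH]; intros z; simpl; [reflexivity|].
      rewrite IH, RtoC_mult, RtoC_pow, Cpow_mult_l; ring. }
    assert (e2 : forall m z, cprod (fun k => t * s k) m z = cprod s m (t * z)%C).
    { induction m as [|m IH]; intros z; simpl; [reflexivity|].
      rewrite IH, RtoC_mult; ring. }
    intros z; rewrite e1, e2; apply hf.
Qed.

(** * Entire series *)

(** Infinite radius of convergence, expressed through the coefficients so that explicit constants
    are at hand. *)
Definition entire (a : nat -> R) : Prop :=
  forall eps, 0 < eps -> exists C, 0 < C /\ forall k, Rabs (a k) <= C * eps ^ k.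

(** Built from real series and therefore total; [csum_cv] shows that for an entire [a] it is the
    limit of the partial sums. *)
Definition cser (a : nat -> R) (w : Complex.C) : Complex.C :=
  (Series (fun k => a k * fst (w ^ k)%C), Series (fun k => a k * snd (w ^ k)%C)).

Lemma INR_le_pow2 (k : nat) : INR k <= 2 ^ k.
Proof.
  induction k as [|k IH]; [simpl; lra|].
  rewrite S_INR; simpl; pose proof (pow_R1_Rle 2 k ltac:(lra)); lra.
Qed.

Lemma entire_INR (a : nat -> R) : entire a -> entire (fun k => INR k * a k).
Proof.
  intros ha eps he; destruct (ha (eps / 2) ltac:(lra)) as (C & hC & h).
  exists C; split; [exact hC|]; intros k.
  rewrite Rabs_mult, (Rabs_right (INR k)) by (apply Rle_ge, pos_INR).
  replace (C * eps ^ k) with (2 ^ k * (C * (eps / 2) ^ k)).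
  - apply Rmult_le_compat; [apply pos_INR|apply Rabs_pos|apply INR_le_pow2|apply h].
  - replace eps with (2 * (eps / 2)) at 2 by field; rewrite Rpow_mult_distr; ring.
Qed.

Lemma entire_ext_le (a b : nat -> R) :
  (forall k, Rabs (b k) <= Rabs (a k)) -> entire a -> entire b.
Proof.
  intros h ha eps he; destruct (ha eps he) as (C & hC & hb).
  exists C; split; [exact hC|]; intros k; eapply Rle_trans; [apply h|apply hb].
Qed.

Lemma entire_geometric (a : nat -> R) (r : R) : 0 <= r -> entire a ->
  exists C, 0 < C /\ forall k, Rabs (a k) * r ^ k <= C * (1 / 2) ^ k.
Proof.
  intros hr ha.
  (* Chosen so that multiplication by [r + 1] gives [1/2]; using [r + 1] in place of [r] covers
     [r = 0]. *)
  destruct (ha (/ (2 * (r + 1)))) as (C & hC & h); [apply Rinv_0_lt_compat; lra|].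
  exists C; split; [exact hC|]; intros k.
  replace (C * (1 / 2) ^ k) with (C * (/ (2 * (r + 1))) ^ k * (r + 1) ^ k).
  - apply Rmult_le_compat; [apply Rabs_pos|apply pow_le; lra|apply h|apply pow_incr; lra].
  - rewrite Rmult_assoc, <- Rpow_mult_distr; do 2 f_equal; field; lra.
Qed.

Lemma rsum_abs_bounded (a : nat -> R) (r : R) : 0 <= r -> entire a ->
  exists K, 0 < K /\ forall M, rsum (fun k => Rabs (a k)) M r <= K.
Proof.
  intros hr ha; destruct (entire_geometric a r hr ha) as (C & hC & h).
  exists (2 * C); split; [lra|]; intros M.
  apply Rle_trans with (2 * C * (1 - (1 / 2) ^ M)).
  - induction M as [|M IH]; simpl; [lra|]; specialize (h M); lra.
  - pose proof (pow_lt (1 / 2) M ltac:(lra)); nra.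
Qed.

Lemma Cmod_le_components (z : Complex.C) : Cmod z <= Rabs (fst z) + Rabs (snd z).
Proof.
  pose proof (Rabs_pos (fst z)); pose proof (Rabs_pos (snd z)).
  apply Rsqr_incr_0_var; [|lra].
  unfold Cmod; rewrite Rsqr_sqrt by nra.
  rewrite <- (pow2_abs (fst z)), <- (pow2_abs (snd z)); unfold Rsqr; nra.
Qed.

Lemma Rabs_fst_le_Cmod (z : Complex.C) : Rabs (fst z) <= Cmod z.
Proof. eapply Rle_trans; [apply Rmax_l|apply Rmax_Cmod]. Qed.

Lemma Rabs_snd_le_Cmod (z : Complex.C) : Rabs (snd z) <= Cmod z.
Proof. eapply Rle_trans; [apply Rmax_r|apply Rmax_Cmod]. Qed.

Lemma entire_ex_series (a : nat -> R) (r : R) (c : nat -> R) : entire a -> 0 <= r ->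
  (forall k, Rabs (c k) <= r ^ k) -> ex_series (fun k => a k * c k).
Proof.
  intros ha hr hc; destruct (entire_geometric a r hr ha) as (C & hC & h).
  apply (ex_series_le (V := R_CompleteNormedModule)) with (fun k => C * (1 / 2) ^ k).
  - intros k; change (Rabs (a k * c k) <= C * (1 / 2) ^ k).
    rewrite Rabs_mult; eapply Rle_trans; [|apply h].
    apply Rmult_le_compat_l; [apply Rabs_pos|apply hc].
  - apply (ex_series_scal (V := R_NormedModule) C (fun k => (1 / 2) ^ k)).
    exists (/ (1 - 1 / 2)); apply is_series_geom; rewrite Rabs_right; lra.
Qed.

Lemma csum_fst (a : nat -> R) (n : nat) (w : Complex.C) :
  fst (csum a (S n) w) = sum_n (fun k => a k * fst (w ^ k)%C) n.
Proof.
  induction n as [|n IH]; [rewrite sum_O; simpl; ring|].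
  rewrite sum_Sn, <- IH.
  change (csum a (S (S n)) w) with (csum a (S n) w + a (S n) * w ^ S n)%C.
  change (fst (csum a (S n) w) + (a (S n) * fst (w ^ S n)%C - 0 * snd (w ^ S n)%C)
    = fst (csum a (S n) w) + a (S n) * fst (w ^ S n)%C); ring.
Qed.

Lemma csum_snd (a : nat -> R) (n : nat) (w : Complex.C) :
  snd (csum a (S n) w) = sum_n (fun k => a k * snd (w ^ k)%C) n.
Proof.
  induction n as [|n IH]; [rewrite sum_O; simpl; ring|].
  rewrite sum_Sn, <- IH.
  change (csum a (S (S n)) w) with (csum a (S n) w + a (S n) * w ^ S n)%C.
  change (snd (csum a (S n) w) + (a (S n) * snd (w ^ S n)%C + 0 * fst (w ^ S n)%C)
    = snd (csum a (S n) w) + a (S n) * snd (w ^ S n)%C); ring.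
Qed.

Lemma csum_cv (a : nat -> R) (w : Complex.C) : entire a ->
  forall eps, 0 < eps -> exists N0, forall N, (N0 <= N)%nat ->
  Cmod (csum a N w - cser a w) < eps.
Proof.
  intros ha eps he.
  assert (h1 : ex_series (fun k => a k * fst (w ^ k)%C)).
  { apply entire_ex_series with (Cmod w); [exact ha|apply Cmod_ge_0|].
    intros k; rewrite <- Cmod_pow; apply Rabs_fst_le_Cmod. }
  assert (h2 : ex_series (fun k => a k * snd (w ^ k)%C)).
  { apply entire_ex_series with (Cmod w); [exact ha|apply Cmod_ge_0|].
    intros k; rewrite <- Cmod_pow; apply Rabs_snd_le_Cmod. }
  apply Series_correct in h1; apply Series_correct in h2.
  assert (l1 : is_lim_seq (fun n => fst (csum a (S n) w)) (fst (cser a w))).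
  { apply is_lim_seq_ext with (sum_n (fun k => a k * fst (w ^ k)%C));
      [intros n; now rewrite csum_fst|exact h1]. }
  assert (l2 : is_lim_seq (fun n => snd (csum a (S n) w)) (snd (cser a w))).
  { apply is_lim_seq_ext with (sum_n (fun k => a k * snd (w ^ k)%C));
      [intros n; now rewrite csum_snd|exact h2]. }
  apply is_lim_seq_spec in l1; apply is_lim_seq_spec in l2.
  destruct (l1 (mkposreal (eps / 2) ltac:(lra))) as [n1 k1].
  destruct (l2 (mkposreal (eps / 2) ltac:(lra))) as [n2 k2].
  exists (S (n1 + n2)); intros [|N] hN; [lia|].
  specialize (k1 N ltac:(lia)); specialize (k2 N ltac:(lia)); simpl pos in k1, k2.
  eapply Rle_lt_trans; [apply Cmod_le_components|].
  change (Rabs (fst (csum a (S N) w) - fst (cser a w))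
    + Rabs (snd (csum a (S N) w) - snd (cser a w)) < eps); lra.
Qed.

Lemma Cmod_csum_le (a b : nat -> R) (n : nat) (w : Complex.C) (r : R) :
  (forall k, Rabs (a k) <= b k) -> Cmod w <= r -> Cmod (csum a n w) <= rsum b n r.
Proof.
  intros hb hw; induction n as [|n IH]; simpl; [rewrite Cmod_0; lra|].
  eapply Rle_trans; [apply Cmod_triangle|].
  rewrite Cmod_mult, Cmod_R, Cmod_pow; apply Rplus_le_compat; [exact IH|].
  apply Rmult_le_compat; [apply Rabs_pos|apply pow_le, Cmod_ge_0|apply hb|].
  apply pow_incr; split; [apply Cmod_ge_0|exact hw].
Qed.

Lemma csum_minus (a b : nat -> R) (n : nat) (w : Complex.C) :
  (csum a n w - csum b n w)%C = csum (fun k => a k - b k) n w.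
Proof.
  induction n as [|n IH]; simpl; [ring|]; rewrite <- IH, RtoC_minus; ring.
Qed.

(** * Approximation of the Dini series *)

Definition bessel_coeff (nu : R) (k : nat) : R := (-1) ^ k / (4 ^ k * INR (fact k) * poch nu k).

(** The factor is [(1 - nu) + (2k + nu)], the effect of the Dini operator on [z^(2k+nu)]. *)
Definition dini_coeff (nu : R) (k : nat) : R := (2 * INR k + 1) * bessel_coeff nu k.

(** The product of [1 - j/N] over [j < k]: a multiplier in [0, 1] that tends to 1 for fixed [k] and
    cuts the series off after degree [N]. *)
Definition lam (N k : nat) : R := fall N k / INR N ^ k.

Definition dini_approx (nu : R) (N k : nat) : R := lam N k * dini_coeff nu k.

Lemma lam_succ (n k : nat) : lam (S n) (S k) = lam (S n) k * (1 - INR k / INR (S n)).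
Proof.
  unfold lam; pose proof (lt_0_INR (S n) ltac:(lia)).
  pose proof (pow_lt _ k H); cbn [fall pow]; field; lra.
Qed.

Lemma lam_bounds (n k : nat) : 0 <= lam (S n) k <= 1.
Proof.
  induction k as [|k IH]; [unfold lam; simpl; lra|].
  rewrite lam_succ; pose proof (lt_0_INR (S n) ltac:(lia)) as hn.
  destruct (Nat.le_gt_cases k (S n)) as [hk|hk].
  - assert (0 <= INR k / INR (S n) <= 1).
    { split; [apply Rdiv_le_0_compat; [apply pos_INR|exact hn]|].
      apply Rle_div_l; [exact hn|]; rewrite Rmult_1_l; apply le_INR, hk. }
    nra.
  - unfold lam; rewrite fall_gt by exact hk; unfold Rdiv; lra.
Qed.

(** A product of [1 - j/N] loses at most the sum of the [j/N], which is below [k^2/N]. *)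
Lemma one_minus_lam (n k : nat) : 1 - lam (S n) k <= INR k * INR k / INR (S n).
Proof.
  pose proof (lt_0_INR (S n) ltac:(lia)) as hn.
  induction k as [|k IH].
  - unfold lam; simpl fall; simpl pow; simpl (INR 0); unfold Rdiv; lra.
  - rewrite lam_succ, (S_INR k); pose proof (lam_bounds n k); pose proof (pos_INR k).
    replace ((INR k + 1) * (INR k + 1) / INR (S n))
      with (INR k * INR k / INR (S n) + INR k / INR (S n) + (INR k + 1) / INR (S n))
      by (field; lra).
    assert (0 <= INR k / INR (S n)) by (apply Rdiv_le_0_compat; lra).
    assert (0 <= (INR k + 1) / INR (S n)) by (apply Rdiv_le_0_compat; lra).
    nra.
Qed.

Lemma geometric_bound (a : nat -> R) (eps : R) (k0 : nat) : 0 < eps ->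
  (forall k, 0 <= a k) ->
  (forall k, (k0 <= k)%nat -> a (S k) <= eps * a k) ->
  exists C, 0 < C /\ forall k, a k <= C * eps ^ k.
Proof.
  intros he ha h.
  assert (hC : exists C, 0 < C /\ forall k, (k <= k0)%nat -> a k <= C * eps ^ k).
  { clear h; induction k0 as [|m (C & hC & IH)].
    - exists (a O + 1); split; [specialize (ha O); lra|].
      intros k hk; replace k with O by lia; simpl; lra.
    - pose proof (pow_lt eps (S m) he) as hp.
      assert (hq : 0 <= a (S m) / eps ^ S m) by (apply Rdiv_le_0_compat; auto).
      exists (C + a (S m) / eps ^ S m); split; [lra|].
      intros k hk; destruct (Nat.eq_dec k (S m)) as [->|].
      + replace ((C + a (S m) / eps ^ S m) * eps ^ S m)
          with (C * eps ^ S m + a (S m)) by (field; lra).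
        pose proof (Rmult_lt_0_compat _ _ hC hp); lra.
      + specialize (IH k ltac:(lia)); pose proof (pow_lt eps k he); nra. }
  destruct hC as (C & hC & hle); exists C; split; [exact hC|].
  intros k; destruct (Nat.le_gt_cases k k0) as [|hk]; [now apply hle|].
  induction k as [|k IH]; [lia|].
  destruct (Nat.eq_dec k k0) as [->|].
  - specialize (h k0 ltac:(lia)); specialize (hle k0 ltac:(lia)); simpl; nra.
  - specialize (h k ltac:(lia)); specialize (IH ltac:(lia)); simpl; nra.
Qed.

Lemma Rabs_dini_coeff (nu : R) (k : nat) : -1 < nu ->
  Rabs (dini_coeff nu k) = (2 * INR k + 1) / (4 ^ k * poch nu k) / INR (fact k).
Proof.
  intros hnu; pose proof (pos_INR k); pose proof (pow_lt 4 k ltac:(lra)).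
  pose proof (poch_pos nu k hnu); pose proof (INR_fact_lt_0 k).
  unfold dini_coeff, bessel_coeff.
  replace ((2 * INR k + 1) * ((-1) ^ k / (4 ^ k * INR (fact k) * poch nu k)))
    with ((-1) ^ k * ((2 * INR k + 1) / (4 ^ k * poch nu k) / INR (fact k)))
    by (field; repeat split; lra).
  rewrite Rabs_mult, pow_1_abs, Rmult_1_l; apply Rabs_right, Rle_ge.
  apply Rdiv_le_0_compat; [|assumption].
  apply Rdiv_le_0_compat; [lra|]; now apply Rmult_lt_0_compat.
Qed.

(** The coefficients contain two factorial-like denominators. One of them, [poch], pays for the
    arbitrarily small geometric ratio; [k!] is kept, so that summation later yields
    [C exp(eps t)]. *)
Lemma dini_coeff_growth (nu eps : R) : -1 < nu -> 0 < eps ->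
  exists C, 0 < C /\ forall k, Rabs (dini_coeff nu k) <= C * eps ^ k / INR (fact k).
Proof.
  intros hnu he.
  destruct (geometric_bound (fun k => (2 * INR k + 1) / (4 ^ k * poch nu k)) eps
    (Z.to_nat (up (1 / eps - nu)))) as (C & hC & h).
  - exact he.
  - intros k; pose proof (pos_INR k); apply Rdiv_le_0_compat; [lra|].
    apply Rmult_lt_0_compat; [apply pow_lt; lra|now apply poch_pos].
  - intros k hk.
    pose proof (pos_INR k); pose proof (pow_lt 4 k ltac:(lra)); pose proof (poch_pos nu k hnu).
    assert (hk' : 1 / eps - nu <= INR k).
    { destruct (archimed (1 / eps - nu)) as [h1 _].
      apply Rle_trans with (IZR (up (1 / eps - nu))); [lra|].
      rewrite INR_IZR_INZ; apply IZR_le; lia. }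
    replace ((2 * INR (S k) + 1) / (4 ^ S k * poch nu (S k)))
      with ((2 * INR k + 3) / (4 * (nu + 1 + INR k)) * / (4 ^ k * poch nu k))
      by (rewrite S_INR; simpl; field; repeat split; lra).
    replace (eps * ((2 * INR k + 1) / (4 ^ k * poch nu k)))
      with (eps * (2 * INR k + 1) * / (4 ^ k * poch nu k)) by (field; repeat split; lra).
    apply Rmult_le_compat_r.
    { apply Rlt_le, Rinv_0_lt_compat, Rmult_lt_0_compat; assumption. }
    apply Rle_div_l; [lra|].
    (* This suffices because [2k + 3 <= 4 (2k + 1)]. *)
    assert (1 <= eps * (nu + 1 + INR k)).
    { replace 1 with (eps * (1 / eps)) at 1 by (field; lra).
      apply Rmult_le_compat_l; lra. }
    nra.
  - exists C; split; [exact hC|]; intros k; rewrite Rabs_dini_coeff by exact hnu.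
    apply Rmult_le_compat_r; [|apply h].
    apply Rlt_le, Rinv_0_lt_compat, INR_fact_lt_0.
Qed.

Lemma entire_dini_coeff (nu : R) : -1 < nu -> entire (dini_coeff nu).
Proof.
  intros hnu eps he; destruct (dini_coeff_growth nu eps hnu he) as (C & hC & h).
  exists C; split; [exact hC|]; intros k; eapply Rle_trans; [apply h|].
  apply Rle_div_l; [apply INR_fact_lt_0|].
  assert (1 <= INR (fact k)) by (apply (le_INR 1), lt_O_fact).
  pose proof (pow_lt eps k he); pose proof (Rmult_lt_0_compat _ _ hC H0); nra.
Qed.

Lemma dini_approx_real_rooted (nu : R) (n : nat) : -1 < nu ->
  real_rooted (dini_approx nu (S n)) (S n).
Proof.
  intros hnu; pose proof (lt_0_INR (S n) ltac:(lia)) as hn.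
  (* Substituting [w / (4N)] supplies both the [4^k] of the Bessel series and the [N^k] of [lam]. *)
  destruct (real_rooted_scale (dlag nu (S n)) (S n) (/ (4 * INR (S n)))) as (s & hs & hf).
  - apply Rinv_0_lt_compat; lra.
  - now apply dlag_real_rooted.
  - exists s; split; [exact hs|]; intros z; rewrite <- hf; apply csum_ext.
    intros k _; unfold dini_approx, dini_coeff, bessel_coeff, lam, dlag, lag.
    pose proof (poch_pos nu k hnu); pose proof (INR_fact_lt_0 k).
    pose proof (pow_lt 4 k ltac:(lra)); pose proof (pow_lt _ k hn).
    rewrite pow_inv, Rpow_mult_distr.
    field; repeat split; lra.
Qed.

Lemma csum_extend (a : nat -> R) (n m : nat) (z : Complex.C) : (n <= m)%nat ->
  (forall k, (n <= k)%nat -> a k = 0) -> csum a m z = csum a n z.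
Proof.
  intros hm ha; induction hm as [|m hm IH]; [reflexivity|].
  simpl; rewrite IH, ha by lia; ring.
Qed.

Lemma Cmod_minus_triangle (x y z : Complex.C) :
  Cmod (x - z) <= Cmod (x - y) + Cmod (y - z).
Proof. replace (x - z)%C with ((x - y) + (y - z))%C by ring; apply Cmod_triangle. Qed.

(** By [one_minus_lam] the error is at most [1/N] times the sum of [k^2 |a_k| r^k], which is finite
    since weighting by [k] twice preserves [entire]. *)
Lemma dini_approx_cv (nu r : R) : -1 < nu -> 0 <= r -> exists K, 0 < K /\
  forall n w, Cmod w <= r ->
  Cmod (csum (dini_approx nu (S n)) (S (S n)) w - cser (dini_coeff nu) w) <= K / INR (S n).
Proof.
  intros hnu hr.
  pose proof (entire_INR _ (entire_INR _ (entire_dini_coeff nu hnu))) as he.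
  destruct (rsum_abs_bounded _ r hr he) as (K & hK & h).
  exists K; split; [exact hK|]; intros n w hw.
  pose proof (lt_0_INR (S n) ltac:(lia)) as hn.
  apply le_epsilon; intros eps heps.
  destruct (csum_cv _ w (entire_dini_coeff nu hnu) eps heps) as [N0 hN0].
  specialize (hN0 (N0 + S (S n))%nat ltac:(lia)).
  eapply Rle_trans;
    [apply (Cmod_minus_triangle _ (csum (dini_coeff nu) (N0 + S (S n)) w))|].
  apply Rplus_le_compat; [|lra].
  (* The coefficients of the approximant vanish beyond its degree, so both sums can be taken to the
     same length and subtracted termwise. *)
  rewrite <- (csum_extend _ (S (S n)) (N0 + S (S n))) at 1.
  2: lia.
  2: { intros k hk; unfold dini_approx, lam; rewrite fall_gt by lia; unfold Rdiv; ring. }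
  rewrite csum_minus.
  eapply Rle_trans; [apply Cmod_csum_le with
    (b := fun k => / INR (S n) * Rabs (INR k * (INR k * dini_coeff nu k))) (r := r)|].
  - intros k; unfold dini_approx.
    replace (lam (S n) k * dini_coeff nu k - dini_coeff nu k)
      with (- ((1 - lam (S n) k) * dini_coeff nu k)) by ring.
    pose proof (lam_bounds n k); pose proof (one_minus_lam n k); pose proof (pos_INR k).
    rewrite Rabs_Ropp, !Rabs_mult, (Rabs_right (INR k)), (Rabs_right (1 - _)) by lra.
    rewrite <- !Rmult_assoc; apply Rmult_le_compat_r; [apply Rabs_pos|].
    unfold Rdiv in *; lra.
  - exact hw.
  - rewrite rsum_scal; unfold Rdiv; rewrite (Rmult_comm K).
    apply Rmult_le_compat_l; [apply Rlt_le, Rinv_0_lt_compat, hn|apply h].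
Qed.

(** * Uniform control of the zeros of the approximants *)

Fixpoint psum (s : nat -> R) (n : nat) : R :=
  match n with
  | O => 0
  | S k => psum s k + s k
  end.

Lemma psum_le (s : nat -> R) (n m : nat) : (forall k, 0 <= s k) -> (n <= m)%nat ->
  psum s n <= psum s m.
Proof. intros hs h; induction h; simpl; [lra|]; specialize (hs m); lra. Qed.

Lemma psum_nonneg (s : nat -> R) (n : nat) : (forall k, 0 <= s k) -> 0 <= psum s n.
Proof. intros hs; exact (psum_le s 0 n hs (Nat.le_0_l n)). Qed.

(** Combined with a uniform bound [A] on the sums, this gives [s k <= A / (k+1)] with no dependence
    on the approximant. *)
Lemma psum_decreasing (s : nat -> R) (k : nat) : (forall k, s (S k) <= s k) ->
  INR (S k) * s k <= psum s (S k).
Proof.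
  intros hd; induction k as [|k IH]; [simpl; lra|].
  change (psum s (S (S k))) with (psum s (S k) + s (S k)); rewrite (S_INR (S k)).
  pose proof (hd k); pose proof (pos_INR (S k)); nra.
Qed.

Lemma rprod_ge_psum (s : nat -> R) (n : nat) (t : R) : (forall k, 0 <= s k) -> 0 <= t ->
  1 + t * psum s n <= rprod s n (- t).
Proof.
  intros hs ht; induction n as [|n IH]; simpl; [lra|].
  pose proof (Rmult_le_pos _ _ ht (hs n)); pose proof (Rmult_le_pos _ _ ht (psum_nonneg s n hs)).
  nra.
Qed.

Lemma exp_monotone (x y : R) : x <= y -> exp x <= exp y.
Proof.
  intros [h|h]; [left; now apply exp_increasing|right; now rewrite h].
Qed.

(** From [exp(-y/2) >= 1 - y/2] and [(1 + y)(1 - y/2) >= 1] on [0, 1]. *)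
Lemma exp_half_le (y : R) : 0 <= y <= 1 -> exp (y / 2) <= 1 + y.
Proof.
  intros hy; pose proof (exp_ineq1_le (- (y / 2))) as h.
  rewrite exp_Ropp in h; pose proof (exp_pos (y / 2)) as hp.
  apply Rmult_le_compat_l with (r := exp (y / 2)) in h; [|lra].
  rewrite Rinv_r in h by lra; nra.
Qed.

(** The first [M] factors are discarded, their product at [- t] being at least 1; each later factor
    is bounded below by [exp_half_le]. *)
Lemma rprod_ge_exp_tail (s : nat -> R) (M n : nat) (t : R) : (forall k, 0 <= s k) -> 0 <= t ->
  (forall k, (M <= k)%nat -> t * s k <= 1) -> (M <= n)%nat ->
  exp (t * (psum s n - psum s M) / 2) <= rprod s n (- t).
Proof.
  intros hs ht hM hn; induction hn as [|n hn IH].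
  - replace (t * (psum s M - psum s M) / 2) with 0 by field; rewrite exp_0.
    pose proof (rprod_ge_psum s M t hs ht).
    pose proof (Rmult_le_pos _ _ ht (psum_nonneg s M hs)); lra.
  - simpl.
    replace (t * (psum s n + s n - psum s M) / 2)
      with (t * (psum s n - psum s M) / 2 + t * s n / 2) by field.
    rewrite exp_plus; apply Rmult_le_compat; [apply Rlt_le, exp_pos..|exact IH|].
    replace (1 - - t * s n) with (1 + t * s n) by ring.
    apply exp_half_le; split; [now apply Rmult_le_pos|now apply hM].
Qed.

Lemma exp_taylor_le (x : R) (n : nat) : 0 <= x -> rsum (fun k => / INR (fact k)) n x <= exp x.
Proof.
  intros hx; destruct n as [|n]; [simpl; apply Rlt_le, exp_pos|].
  replace (rsum (fun k => / INR (fact k)) (S n) x)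
    with (sum_f_R0 (fun k => / INR (fact k) * x ^ k) n).
  - apply sum_incr.
    + unfold exp; destruct (exist_exp x) as [l hl]; exact hl.
    + intros k; apply Rmult_le_pos; [|now apply pow_le].
      apply Rlt_le, Rinv_0_lt_compat, INR_fact_lt_0.
  - induction n as [|n IH]; [simpl; ring|]; rewrite tech5, IH; reflexivity.
Qed.

Lemma dini_approx_growth (nu eps : R) : -1 < nu -> 0 < eps -> exists C, 0 < C /\
  forall n m t, 0 <= t -> rsum (dini_approx nu (S n)) m (- t) <= C * exp (eps * t).
Proof.
  intros hnu he; destruct (dini_coeff_growth nu eps hnu he) as (C & hC & h).
  exists C; split; [exact hC|]; intros n m t ht.
  apply Rle_trans with (rsum (fun k => C * eps ^ k / INR (fact k)) m t).
  - induction m as [|m IH]; simpl; [lra|]; apply Rplus_le_compat; [exact IH|].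
    eapply Rle_trans; [apply Rle_abs|].
    rewrite Rabs_mult, <- RPow_abs, Rabs_Ropp, (Rabs_right t) by lra.
    apply Rmult_le_compat_r; [now apply pow_le|].
    eapply Rle_trans; [|apply h]; unfold dini_approx; rewrite Rabs_mult.
    pose proof (lam_bounds n m); rewrite (Rabs_right (lam _ _)) by lra.
    pose proof (Rabs_pos (dini_coeff nu m)); nra.
  - replace (rsum (fun k => C * eps ^ k / INR (fact k)) m t)
      with (C * rsum (fun k => / INR (fact k)) m (eps * t)).
    + apply Rmult_le_compat_l; [lra|apply exp_taylor_le, Rmult_le_pos; lra].
    + induction m as [|m IH]; simpl; [ring|].
      rewrite Rmult_plus_distr_l, IH, Rpow_mult_distr; unfold Rdiv; ring.
Qed.

(** An inverse 0 stands for a zero at infinity: its factor is 1, so sequences of all degrees live in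
    one space. *)
Definition pad (n : nat) (s : nat -> R) (k : nat) : R := if Nat.ltb k n then s k else 0.

Lemma pad_lt (n : nat) (s : nat -> R) (k : nat) : (k < n)%nat -> pad n s k = s k.
Proof. intros h; unfold pad; destruct (Nat.ltb_spec k n); [reflexivity|lia]. Qed.

Lemma pad_ge (n : nat) (s : nat -> R) (k : nat) : (n <= k)%nat -> pad n s k = 0.
Proof. intros h; unfold pad; destruct (Nat.ltb_spec k n); [lia|reflexivity]. Qed.

Lemma cprod_pad (n m : nat) (s : nat -> R) (z : Complex.C) : (n <= m)%nat ->
  cprod (pad n s) m z = cprod s n z.
Proof.
  intros h; induction h as [|m h IH].
  - assert (e : forall k, (k <= n)%nat -> cprod (pad n s) k z = cprod s k z); [|now apply e].
    induction k as [|k IH]; intros hk; [reflexivity|].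
    simpl; rewrite IH, pad_lt by lia; reflexivity.
  - simpl; rewrite IH, pad_ge by exact h; ring.
Qed.

Lemma psum_pad (n m : nat) (s : nat -> R) : (n <= m)%nat -> psum (pad n s) m = psum s n.
Proof.
  intros h; induction h as [|m h IH].
  - assert (e : forall k, (k <= n)%nat -> psum (pad n s) k = psum s k); [|now apply e].
    induction k as [|k IH]; intros hk; [reflexivity|].
    simpl; rewrite IH, pad_lt by lia; reflexivity.
  - simpl; rewrite IH, pad_ge by exact h; ring.
Qed.

Definition nonincreasing_nonneg (s : nat -> R) : Prop :=
  (forall k, 0 <= s k) /\ (forall k, s (S k) <= s k).

Definition uniform_tails (s : nat -> nat -> R) : Prop :=
  forall eps, 0 < eps -> exists M, forall n k, (M <= k)%nat ->
  psum (s n) k - psum (s n) M <= eps.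

Lemma le_INR_up (x : R) (k : nat) : (Z.to_nat (up x) <= k)%nat -> x <= INR k.
Proof.
  intros h; destruct (archimed x) as [h1 _]; apply Rle_trans with (IZR (up x)); [lra|].
  rewrite INR_IZR_INZ; apply IZR_le; lia.
Qed.

(* Growth of order less than one: [exp (t * tail / 2) <= P_n(-t) <= C * exp (eps * t / 4)], so
   no mass of the [1 / zero] escapes to the tail. *)
Lemma tails_of_growth (s : nat -> nat -> R) (A : R) :
  (forall n, nonincreasing_nonneg (s n)) ->
  (forall n k, psum (s n) k <= A) ->
  (forall eps, 0 < eps -> exists C, 0 < C /\
     forall n k t, 0 <= t -> rprod (s n) k (- t) <= C * exp (eps * t)) ->
  uniform_tails s.
Proof.
  intros hs hA hg eps he.
  destruct (hg (eps / 4) ltac:(lra)) as (C & hC & hgr).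
  (* Makes [ln C] at most [eps * t / 4], so the exponent in the upper bound is at most
     [eps * t / 2]. *)
  set (t := 1 + 4 * Rabs (ln C) / eps).
  assert (ht : 1 <= t).
  { pose proof (Rabs_pos (ln C)); unfold t.
    assert (0 <= 4 * Rabs (ln C) / eps) by (apply Rdiv_le_0_compat; lra); lra. }
  (* From index [t * A] on, [psum_decreasing] gives [t * s n j <= 1], the range of [exp_half_le];
     this index does not depend on [n]. *)
  exists (Z.to_nat (up (t * A))); intros n k hk.
  destruct (hs n) as [hp hd].
  assert (hsmall : forall j, (Z.to_nat (up (t * A)) <= j)%nat -> t * s n j <= 1).
  { intros j hj; pose proof (le_INR_up _ _ hj); pose proof (pos_INR j).
    pose proof (psum_decreasing (s n) j hd); pose proof (hA n (S j)).
    apply Rmult_le_reg_l with (INR (S j)); [apply lt_0_INR; lia|].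
    rewrite S_INR in *; nra. }
  pose proof (rprod_ge_exp_tail (s n) _ k t hp ltac:(lra) hsmall hk) as h1.
  specialize (hgr n k t ltac:(lra)).
  set (T := psum (s n) k - psum (s n) (Z.to_nat (up (t * A)))) in *.
  assert (h2 : exp (t * T / 2) <= exp (ln C + eps / 4 * t))
    by (rewrite exp_plus, exp_ln by exact hC; lra).
  assert (h3 : t * T / 2 <= ln C + eps / 4 * t).
  { destruct (Rle_or_lt (t * T / 2) (ln C + eps / 4 * t)) as [|h3]; [assumption|].
    apply exp_increasing in h3; lra. }
  assert (h4 : Rabs (ln C) * 4 <= t * eps).
  { unfold t; replace ((1 + 4 * Rabs (ln C) / eps) * eps)
      with (eps + 4 * Rabs (ln C)) by (field; lra); lra. }
  pose proof (Rle_abs (ln C)); apply Rmult_le_reg_l with t; lra.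
Qed.

Lemma approximants (nu : R) : -1 < nu -> exists (s : nat -> nat -> R) (A : R),
  (forall n, nonincreasing_nonneg (s n)) /\
  (forall n k, psum (s n) k <= A) /\
  uniform_tails s /\
  (forall r, 0 <= r -> exists K, 0 < K /\ forall n k w, Cmod w <= r -> (S n <= k)%nat ->
     Cmod (cprod (s n) k w - cser (dini_coeff nu) w) <= K / INR (S n)).
Proof.
  intros hnu.
  assert (hex : forall n, exists s, decreasing_below (S n) s /\
    forall z, csum (dini_approx nu (S n)) (S (S n)) z = cprod s (S n) z).
  { intros n; exact (dini_approx_real_rooted nu n hnu). }
  set (s0 := fun n => proj1_sig (constructive_indefinite_description _ (hex n))).
  assert (hs0 : forall n, decreasing_below (S n) (s0 n) /\
    forall z, csum (dini_approx nu (S n)) (S (S n)) z = cprod (s0 n) (S n) z).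
  { intros n; exact (proj2_sig (constructive_indefinite_description _ (hex n))). }
  clearbody s0; clear hex.
  set (s := fun n => pad (S n) (s0 n)).
  assert (hs : forall n, nonincreasing_nonneg (s n)).
  { intros n; destruct (hs0 n) as [[hp hd] _]; split; intros k; unfold s.
    - destruct (Nat.lt_ge_cases k (S n)); [rewrite pad_lt by assumption|rewrite pad_ge by assumption; lra].
      apply Rlt_le, hp; assumption.
    - destruct (Nat.lt_ge_cases (S k) (S n)).
      + rewrite !pad_lt by lia; apply Rlt_le, hd; lia.
      + rewrite (pad_ge _ _ (S k)) by assumption.
        destruct (Nat.lt_ge_cases k (S n)); [rewrite pad_lt by assumption|rewrite pad_ge by assumption; lra].
        apply Rlt_le, hp; assumption. }
  assert (hP : forall n k z, (S n <= k)%nat ->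
    cprod (s n) k z = csum (dini_approx nu (S n)) (S (S n)) z).
  { intros n k z hk; unfold s; rewrite cprod_pad by exact hk; symmetry; apply hs0. }
  (* [k] may be smaller than the degree: on the negative axis dropping factors only decreases the
     product. *)
  assert (hmono : forall n k t, 0 <= t ->
    rprod (s n) k (- t) <= rsum (dini_approx nu (S n)) (S (S n)) (- t)).
  { intros n k t ht.
    apply Rle_trans with (rprod (s n) (k + S n) (- t)).
    - assert (h : forall m, rprod (s n) k (- t) <= rprod (s n) (k + m) (- t)).
      { induction m as [|m IH]; [rewrite Nat.add_0_r; lra|].
        rewrite Nat.add_succ_r; simpl.
        pose proof (rprod_ge_psum (s n) (k + m) t (proj1 (hs n)) ht).
        pose proof (Rmult_le_pos _ _ ht (proj1 (hs n) (k + m)%nat)).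
        pose proof (Rmult_le_pos _ _ ht (psum_nonneg (s n) (k + m) (proj1 (hs n)))).
        nra. }
      apply h.
    - right; apply RtoC_inj; rewrite <- cprod_RtoC, <- csum_RtoC; apply hP; lia. }
  assert (hg : forall eps, 0 < eps -> exists C, 0 < C /\
     forall n k t, 0 <= t -> rprod (s n) k (- t) <= C * exp (eps * t)).
  { intros eps he; destruct (dini_approx_growth nu eps hnu he) as (C & hC & h).
    exists C; split; [exact hC|]; intros n k t ht.
    eapply Rle_trans; [now apply hmono|now apply h]. }
  (* At [t = 1] the growth bound dominates [1 + psum], which gives the uniform bound [C * exp 1] on
     the sums of inverse zeros. *)
  destruct (hg 1 ltac:(lra)) as (C & hC & hgC).
  assert (hA : forall n k, psum (s n) k <= C * exp 1).
  { intros n k; specialize (hgC n k 1 ltac:(lra)).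
    pose proof (rprod_ge_psum (s n) k 1 (proj1 (hs n)) ltac:(lra)).
    rewrite Rmult_1_l in hgC; lra. }
  exists s, (C * exp 1); split; [exact hs|split; [exact hA|split]].
  - now apply tails_of_growth with (C * exp 1).
  - intros r hr; destruct (dini_approx_cv nu r hnu hr) as (K & hK & h).
    exists K; split; [exact hK|]; intros n k w hw hk; rewrite hP by exact hk; now apply h.
Qed.

(** * The limiting zeros *)

(** Cluster point in the first [k] coordinates. Asking for arbitrarily large [n] with all [k]
    coordinates close at once makes explicit subsequences unnecessary. *)
Definition prefix_cluster (s : nat -> nat -> R) (x : nat -> R) (k : nat) : Prop :=
  forall eps N0, 0 < eps -> exists n, (N0 <= n)%nat /\
  forall j, (j < k)%nat -> Rabs (s n j - x j) < eps.

(** Along indices at which the first [k] coordinates are within [1/(m+1)], the next coordinate stays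
    in a compact interval and has a cluster value; the old coordinates are left untouched. *)
Lemma prefix_cluster_succ (s : nat -> nat -> R) (A : R) (x : nat -> R) (k : nat) :
  (forall n k, 0 <= s n k <= A) -> prefix_cluster s x k ->
  exists y, (forall j, (j < k)%nat -> y j = x j) /\ prefix_cluster s y (S k).
Proof.
  intros hA hx.
  assert (hpos : forall m, 0 < / INR (S m)) by (intros; apply Rinv_0_lt_compat, lt_0_INR; lia).
  set (phi := fun m => proj1_sig (constructive_indefinite_description _ (hx _ m (hpos m)))).
  assert (hphi : forall m, (m <= phi m)%nat /\
    forall j, (j < k)%nat -> Rabs (s (phi m) j - x j) < / INR (S m)).
  { intros m; exact (proj2_sig (constructive_indefinite_description _ (hx _ m (hpos m)))). }
  clearbody phi.
  destruct (Bolzano_Weierstrass (fun m => s (phi m) k) (fun c => 0 <= c <= A)) as [l hl].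
  - apply compact_P3.
  - intros m; apply hA.
  - exists (fun j => if Nat.ltb j k then x j else l); split.
    + intros j hj; destruct (Nat.ltb_spec j k); [reflexivity|lia].
    + intros eps N0 he.
      set (N1 := Z.to_nat (up (/ eps))).
      destruct (hl (disc l (mkposreal eps he)) (N0 + N1)%nat) as [p [hp hd]].
      { exists (mkposreal eps he); intros y hy; exact hy. }
      destruct (hphi p) as [h1 h2]; exists (phi p); split; [lia|].
      intros j hj; destruct (Nat.ltb_spec j k) as [hjk|hjk].
      * apply Rlt_le_trans with (/ INR (S p)); [now apply h2|].
        rewrite <- (Rinv_inv eps); apply Rinv_le_contravar; [now apply Rinv_0_lt_compat|].
        rewrite S_INR; pose proof (le_INR_up (/ eps) p ltac:(unfold N1 in *; lia)); lra.
      * replace j with k by lia; exact hd.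
Qed.

(** A diagonal argument by dependent choice. Later stages never change earlier coordinates, so
    coordinate [j] can be read off at stage [j + 1]. *)
Lemma cluster_sequence (s : nat -> nat -> R) (A : R) : (forall n k, 0 <= s n k <= A) ->
  exists x, forall k, prefix_cluster s x k.
Proof.
  intros hA.
  assert (h0 : prefix_cluster s (fun _ => 0) 0).
  { intros eps N0 he; exists N0; split; [lia|intros; lia]. }
  set (step := fun k (f : {x | prefix_cluster s x k}) =>
    let e := constructive_indefinite_description _
      (prefix_cluster_succ s A (proj1_sig f) k hA (proj2_sig f)) in
    exist (fun x => prefix_cluster s x (S k)) (proj1_sig e) (proj2 (proj2_sig e))).
  set (X := nat_rect (fun k => {x | prefix_cluster s x k}) 
    (exist (fun x => prefix_cluster s x 0) _ h0) step).
  assert (hstep : forall k j, (j < k)%nat -> proj1_sig (X (S k)) j = proj1_sig (X k) j).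
  { intros k j hj; unfold X; simpl.
    exact (proj1 (proj2_sig (constructive_indefinite_description _
      (prefix_cluster_succ s A _ k hA (proj2_sig (X k))))) j hj). }
  exists (fun j => proj1_sig (X (S j)) j); intros k eps N0 he.
  destruct (proj2_sig (X k) eps N0 he) as [n [hn h]].
  exists n; split; [exact hn|]; intros j hj; specialize (h j hj).
  replace (proj1_sig (X (S j)) j) with (proj1_sig (X k) j); [exact h|].
  clear h; induction hj as [|m hm IH]; [reflexivity|].
  rewrite hstep by exact hm; exact IH.
Qed.

(** * Dependence of the products on the inverse zeros *)

Lemma psum_close (s x : nat -> R) (k : nat) (eps : R) :
  (forall j, (j < k)%nat -> Rabs (s j - x j) < eps) ->
  psum (fun j => Rabs (x j - s j)) k <= INR k * eps.
Proof.
  intros h; induction k as [|k IH]; [simpl; lra|].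
  rewrite S_INR; simpl psum; specialize (IH ltac:(auto)); specialize (h k ltac:(lia)).
  rewrite Rabs_minus_sym in h; lra.
Qed.

Lemma psum_abs_diff (s x : nat -> R) (M k : nat) : (M <= k)%nat ->
  psum x k - psum x M <= psum s k - psum s M + psum (fun j => Rabs (x j - s j)) k.
Proof.
  intros h; induction h as [|k h IH].
  - pose proof (psum_nonneg (fun j => Rabs (x j - s j)) M (fun j => Rabs_pos _)); lra.
  - simpl; pose proof (Rle_abs (x k - s k)); lra.
Qed.

Lemma Cmod_one_minus_le (w : Complex.C) (r y : R) : Cmod w <= r -> 0 <= y ->
  Cmod (1 - w * y) <= exp (r * y).
Proof.
  intros hw hy; apply Rle_trans with (1 + r * y).
  - unfold Cminus; eapply Rle_trans; [apply Cmod_triangle|].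
    rewrite Cmod_opp, Cmod_mult, Cmod_1, Cmod_R, (Rabs_right y) by lra; nra.
  - apply exp_ineq1_le.
Qed.

Lemma Cmod_cprod_le (x : nat -> R) (n : nat) (w : Complex.C) (r : R) :
  (forall k, 0 <= x k) -> Cmod w <= r -> Cmod (cprod x n w) <= exp (r * psum x n).
Proof.
  intros hx hw; induction n as [|n IH]; simpl.
  - rewrite Cmod_1, Rmult_0_r, exp_0; lra.
  - rewrite Cmod_mult, Rmult_plus_distr_l, exp_plus.
    apply Rmult_le_compat; [apply Cmod_ge_0..|exact IH|now apply Cmod_one_minus_le].
Qed.

(** Replacing one factor at a time shows that the product is Lipschitz for the l1 distance of the
    inverse zeros; the constant involves only their sums, not the number of factors. *)
Lemma Cmod_cprod_diff (x y : nat -> R) (n : nat) (w : Complex.C) (r : R) :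
  (forall k, 0 <= x k) -> (forall k, 0 <= y k) -> Cmod w <= r ->
  Cmod (cprod x n w - cprod y n w)
  <= r * psum (fun k => Rabs (x k - y k)) n * exp (r * (psum x n + psum y n)).
Proof.
  intros hx hy hw; assert (hr : 0 <= r) by (pose proof (Cmod_ge_0 w); lra).
  induction n as [|n IH]; simpl.
  - replace (1 - 1)%C with (RtoC 0) by ring; rewrite Cmod_0; lra.
  - replace (cprod x n w * (1 - w * x n) - cprod y n w * (1 - w * y n))%C
      with ((cprod x n w - cprod y n w) * (1 - w * x n)
            + - (cprod y n w * (w * (x n - y n)%R)))%C by (rewrite RtoC_minus; ring).
    eapply Rle_trans; [apply Cmod_triangle|].
    rewrite Cmod_opp, !Cmod_mult, Cmod_R.
    pose proof (psum_nonneg x n hx) as hX; pose proof (psum_nonneg y n hy) as hY.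
    set (D := psum (fun k => Rabs (x k - y k)) n) in *.
    assert (hD : 0 <= D) by (apply psum_nonneg; intros; apply Rabs_pos).
    replace (r * (psum x n + x n + (psum y n + y n)))
      with (r * (psum x n + psum y n) + r * x n + r * y n) by ring.
    rewrite !exp_plus; set (E := exp (r * (psum x n + psum y n))) in *.
    assert (h1 : 1 <= exp (r * x n)).
    { pose proof (exp_ineq1_le (r * x n)); pose proof (Rmult_le_pos _ _ hr (hx n)); lra. }
    assert (h2 : 1 <= exp (r * y n)).
    { pose proof (exp_ineq1_le (r * y n)); pose proof (Rmult_le_pos _ _ hr (hy n)); lra. }
    assert (hE : 0 < E) by apply exp_pos.
    assert (hyE : Cmod (cprod y n w) <= E).
    { eapply Rle_trans; [apply Cmod_cprod_le; [exact hy|exact hw]|].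
      unfold E; rewrite Rmult_plus_distr_l, exp_plus.
      assert (1 <= exp (r * psum x n)).
      { pose proof (exp_ineq1_le (r * psum x n)); pose proof (Rmult_le_pos _ _ hr hX); lra. }
      pose proof (exp_pos (r * psum y n)); nra. }
    assert (hfirst : Cmod (cprod x n w - cprod y n w) * Cmod (1 - w * x n)
      <= r * D * E * exp (r * x n)).
    { apply Rmult_le_compat; [apply Cmod_ge_0..|exact IH|now apply Cmod_one_minus_le]. }
    assert (hsecond : Cmod (cprod y n w) * (Cmod w * Rabs (x n - y n))
      <= E * (r * Rabs (x n - y n))).
    { apply Rmult_le_compat; [apply Cmod_ge_0| |exact hyE|].
      - apply Rmult_le_pos; [apply Cmod_ge_0|apply Rabs_pos].
      - apply Rmult_le_compat_r; [apply Rabs_pos|exact hw]. }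
    set (d := Rabs (x n - y n)) in *.
    assert (hd : 0 <= d) by apply Rabs_pos.
    assert (e1 : 0 <= r * D * E) by (repeat apply Rmult_le_pos; lra).
    assert (e2 : 0 <= r * d * E) by (repeat apply Rmult_le_pos; lra).
    set (p := exp (r * x n)) in *; set (q := exp (r * y n)) in *.
    assert (r * D * E * p <= r * D * E * (p * q)) by (apply Rmult_le_compat_l; nra).
    assert (r * d * E * 1 <= r * d * E * (p * q)) by (apply Rmult_le_compat_l; nra).
    lra.
Qed.

Lemma dini_product (nu : R) : -1 < nu -> exists (x : nat -> R) (A : R),
  nonincreasing_nonneg x /\
  (forall k, psum x k <= A) /\
  (forall eps, 0 < eps -> exists M, forall k, (M <= k)%nat -> psum x k - psum x M <= eps) /\
  (forall r eps, 0 <= r -> 0 < eps -> exists K0, forall K w, (K0 <= K)%nat -> Cmod w <= r ->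
     Cmod (cprod x K w - cser (dini_coeff nu) w) <= eps).
Proof.
  intros hnu; destruct (approximants nu hnu) as (s & A & hs & hA & ht & hcv).
  assert (hb : forall n k, 0 <= s n k <= A).
  { intros n k; split; [apply hs|].
    pose proof (psum_nonneg (s n) k (proj1 (hs n))); pose proof (hA n (S k)); simpl in *; lra. }
  destruct (cluster_sequence s A hb) as [x hx].
  assert (happ : forall k eps N0, 0 < eps -> exists n, (N0 <= n)%nat /\
    (forall j, (j < k)%nat -> Rabs (s n j - x j) < eps) /\
    psum (fun j => Rabs (x j - s n j)) k <= eps).
  { intros k eps N0 he; pose proof (pos_INR k).
    (* Per-coordinate accuracy that leaves a total error of at most [eps] over [k] coordinates. *)
    assert (hk : 0 < eps / (INR k + 1)) by (apply Rdiv_lt_0_compat; lra).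
    destruct (hx k (eps / (INR k + 1)) N0 hk) as [n [hn h]].
    exists n; split; [exact hn|split].
    - intros j hj; eapply Rlt_le_trans; [now apply h|].
      apply Rle_div_l; [lra|]; nra.
    - eapply Rle_trans; [apply psum_close; exact h|].
      replace (INR k * (eps / (INR k + 1))) with (INR k * eps / (INR k + 1)) by (field; lra).
      apply Rle_div_l; [lra|]; nra. }
  assert (hx0 : forall k, 0 <= x k).
  { intros k; apply le_epsilon; intros eps he.
    destruct (happ (S k) eps O he) as [n [_ [h _]]]; specialize (h k ltac:(lia)).
    apply Rabs_def2 in h; pose proof (hb n k); lra. }
  assert (hxA : forall k, psum x k <= A).
  { intros k; apply le_epsilon; intros eps he; destruct (happ k eps O he) as [n [_ [_ h]]].
    pose proof (psum_abs_diff (s n) x 0 k ltac:(lia)); pose proof (hA n k); simpl in *; lra. }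
  exists x, A; split; [split; [exact hx0|]|split; [exact hxA|split]].
  - intros k; apply le_epsilon; intros eps he.
    destruct (happ (S (S k)) (eps / 2) O ltac:(lra)) as [n [_ [h _]]].
    pose proof (h k ltac:(lia)) as h1; pose proof (h (S k) ltac:(lia)) as h2.
    apply Rabs_def2 in h1; apply Rabs_def2 in h2; pose proof (proj2 (hs n) k); lra.
  - intros eps he; destruct (ht (eps / 2) ltac:(lra)) as [M hM].
    exists M; intros k hk; destruct (happ k (eps / 2) O ltac:(lra)) as [n [_ [_ h]]].
    pose proof (psum_abs_diff (s n) x M k hk); specialize (hM n k hk); lra.
  - intros r eps hr he.
    set (E := exp (r * (A + A))); assert (hE : 0 < E) by apply exp_pos.
    (* The l1 distance will be at most [2 * delta]: one [delta] from the first [K] coordinates, one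
       from the tail of [s n]. The [r + 1] again covers [r = 0]. *)
    set (delta := eps / (4 * (r + 1) * E)).
    assert (hden : 0 < 4 * (r + 1) * E) by (apply Rmult_lt_0_compat; lra).
    assert (hdelta : 0 < delta) by (apply Rdiv_lt_0_compat; lra).
    assert (hde : r * (2 * delta) * E <= eps / 2).
    { unfold delta; replace (r * (2 * (eps / (4 * (r + 1) * E))) * E)
        with (r / (r + 1) * (eps / 2)) by (field; lra).
      assert (r / (r + 1) <= 1) by (apply Rle_div_l; lra).
      assert (0 < eps / 2) by lra; nra. }
    destruct (ht delta hdelta) as [M hM].
    destruct (hcv r hr) as (B & hB & hBcv).
    exists M; intros K w hK hw.
    (* [n] is chosen after [K], large enough that the approximant is within [eps / 2] of the series;
       the threshold [M] for [K] does not depend on it. *)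
    destruct (happ K delta (Z.to_nat (up (2 * B / eps))) hdelta) as [n [hn [_ hclose]]].
    eapply Rle_trans; [apply (Cmod_minus_triangle _ (cprod (s n) (K + S n) w))|].
    assert (h2 : B / INR (S n) <= eps / 2).
    { pose proof (le_INR_up _ _ hn) as h; pose proof (pos_INR n).
      apply Rle_div_l; [apply lt_0_INR; lia|]; rewrite S_INR.
      apply Rmult_le_compat_r with (r := eps) in h; [|lra].
      unfold Rdiv in h; rewrite Rmult_assoc, Rinv_l in h by lra; nra. }
    specialize (hBcv n (K + S n)%nat w hw ltac:(lia)).
    assert (h1 : Cmod (cprod x K w - cprod (s n) (K + S n) w) <= eps / 2); [|lra].
    (* [x] is cut off at [K] and padded to the length at which [s n] already has all its factors. *)
    rewrite <- (cprod_pad K (K + S n) x w) by lia.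
    assert (hpad0 : forall k, 0 <= pad K x k).
    { intros k; destruct (Nat.lt_ge_cases k K);
        [rewrite pad_lt by assumption; apply hx0|rewrite pad_ge by assumption; lra]. }
    eapply Rle_trans;
      [apply Cmod_cprod_diff with (r := r); [exact hpad0|apply hs|exact hw]|].
    assert (hsum : forall m, (K <= m)%nat -> psum (fun k => Rabs (pad K x k - s n k)) m
      <= delta + (psum (s n) m - psum (s n) K)).
    { intros m hm; induction hm as [|m hm IH].
      - assert (e : forall k, (k <= K)%nat -> psum (fun k => Rabs (pad K x k - s n k)) k
          = psum (fun k => Rabs (x k - s n k)) k).
        { induction k as [|k IH]; intros hk; [reflexivity|].
          simpl; rewrite IH, pad_lt by lia; reflexivity. }
        rewrite e by lia; lra.
      - simpl; rewrite pad_ge by exact hm.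
        rewrite Rabs_minus_sym, Rminus_0_r, (Rabs_right (s n m)) by (apply Rle_ge, hs); lra. }
    specialize (hsum (K + S n)%nat ltac:(lia)).
    pose proof (hM n (K + S n)%nat ltac:(lia)) as hM1.
    pose proof (psum_le (s n) M K (proj1 (hs n)) hK).
    rewrite psum_pad by lia.
    eapply Rle_trans; [|exact hde].
    apply Rmult_le_compat.
    + apply Rmult_le_pos; [exact hr|apply psum_nonneg; intros; apply Rabs_pos].
    + apply Rlt_le, exp_pos.
    + apply Rmult_le_compat_l; [exact hr|lra].
    + unfold E; apply exp_monotone.
      apply Rmult_le_compat_l; [exact hr|].
      pose proof (hxA K); pose proof (hA n (K + S n)%nat); lra.
Qed.

(** * Simplicity of the positive zeros *)

Lemma entire_CV_radius (a : nat -> R) (x : R) : entire a -> Rbar_lt (Rabs x) (CV_radius a).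
Proof.
  intros ha.
  assert (hx : 0 <= Rabs x + 1) by (pose proof (Rabs_pos x); lra).
  destruct (entire_geometric a (Rabs x + 1) hx ha) as (C & hC & h).
  apply Rbar_lt_le_trans with (Finite (Rabs x + 1)); [simpl; lra|].
  apply (proj1 (CV_radius_bounded a)); exists C; intros n.
  rewrite Rabs_mult, (Rabs_right (_ ^ n)) by (apply Rle_ge, pow_le, hx).
  eapply Rle_trans; [apply h|].
  assert ((1 / 2) ^ n <= 1 ^ n) by (apply pow_incr; lra).
  rewrite pow1 in *; nra.
Qed.

Lemma entire_bessel_coeff (nu : R) : -1 < nu -> entire (bessel_coeff nu).
Proof.
  intros hnu; apply (entire_ext_le (dini_coeff nu)); [|now apply entire_dini_coeff].
  intros k; unfold dini_coeff; rewrite Rabs_mult.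
  pose proof (pos_INR k); pose proof (Rabs_pos (bessel_coeff nu k)).
  rewrite (Rabs_right (2 * INR k + 1)) by lra; nra.
Qed.

Lemma bessel_coeff_succ (nu : R) (k : nat) : -1 < nu ->
  (INR k + 1) * (nu + 1 + INR k) * bessel_coeff nu (S k) = - bessel_coeff nu k / 4.
Proof.
  intros hnu; unfold bessel_coeff.
  pose proof (poch_pos nu k hnu); pose proof (INR_fact_lt_0 k); pose proof (pos_INR k).
  pose proof (pow_lt 4 k ltac:(lra)).
  rewrite fact_simpl, mult_INR, S_INR; simpl; field; repeat split; lra.
Qed.

(** Bessel's equation in the variable [z^2] after removal of [z^nu]; on coefficients it is the
    two-term recurrence [bessel_coeff_succ]. *)
Lemma bessel_ode (nu x : R) : -1 < nu ->
  let c := bessel_coeff nu in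
  x * PSeries (PS_derive (PS_derive c)) x + (nu + 1) * PSeries (PS_derive c) x
  + PSeries c x / 4 = 0.
Proof.
  intros hnu c; pose proof (entire_bessel_coeff nu hnu) as hc; fold c in hc.
  assert (e0 : ex_pseries c x) by (apply CV_radius_inside, entire_CV_radius, hc).
  assert (e1 : ex_pseries (PS_derive c) x)
    by (apply CV_radius_inside; rewrite CV_radius_derive; apply entire_CV_radius, hc).
  assert (e2 : ex_pseries (PS_derive (PS_derive c)) x)
    by (apply CV_radius_inside; rewrite !CV_radius_derive; apply entire_CV_radius, hc).
  rewrite <- PSeries_incr_1, <- PSeries_scal.
  replace (PSeries c x / 4) with (/ 4 * PSeries c x) by field.
  rewrite <- PSeries_scal, <- !PSeries_plus.
  - rewrite <- (PSeries_const_0 x); apply PSeries_ext; intros [|k].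
    + change (0 + (nu + 1) * (INR 1 * c 1%nat) + / 4 * c O = 0).
      pose proof (bessel_coeff_succ nu 0 hnu) as h; fold c in h; simpl in *; lra.
    + change (INR (S k) * (INR (S (S k)) * c (S (S k)))
        + (nu + 1) * (INR (S (S k)) * c (S (S k))) + / 4 * c (S k) = 0).
      pose proof (bessel_coeff_succ nu (S k) hnu) as h; fold c in h.
      rewrite (S_INR (S k)); lra.
  - apply ex_pseries_plus; [now apply ex_pseries_incr_1|].
    apply ex_pseries_scal; [apply Rmult_comm|exact e1].
  - apply ex_pseries_scal; [apply Rmult_comm|exact e0].
  - now apply ex_pseries_incr_1.
  - apply ex_pseries_scal; [apply Rmult_comm|exact e1].
Qed.

Lemma dini_PSeries (nu x : R) : -1 < nu ->
  PSeries (dini_coeff nu) x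
  = PSeries (bessel_coeff nu) x + 2 * (x * PSeries (PS_derive (bessel_coeff nu)) x).
Proof.
  intros hnu; pose proof (entire_bessel_coeff nu hnu) as hc.
  rewrite <- PSeries_incr_1, <- PSeries_scal, <- PSeries_plus.
  - apply PSeries_ext; intros [|k].
    + change ((2 * INR 0 + 1) * bessel_coeff nu 0 = bessel_coeff nu 0 + 2 * 0); simpl; ring.
    + change ((2 * INR (S k) + 1) * bessel_coeff nu (S k)
        = bessel_coeff nu (S k) + 2 * (INR (S k) * bessel_coeff nu (S k))); ring.
  - apply CV_radius_inside, entire_CV_radius, hc.
  - apply ex_pseries_scal; [apply Rmult_comm|]; apply ex_pseries_incr_1, CV_radius_inside.
    rewrite CV_radius_derive; apply entire_CV_radius, hc.
Qed.

Lemma is_derive_entire (a : nat -> R) (x : R) : entire a ->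
  is_derive (PSeries a) x (PSeries (PS_derive a) x) /\
  is_derive (PSeries (PS_derive a)) x (PSeries (PS_derive (PS_derive a)) x).
Proof.
  intros ha; split; apply is_derive_PSeries; rewrite ?CV_radius_derive;
    now apply entire_CV_radius.
Qed.

(* Lommel's integral in differential form: up to a factor, [x^(nu+1)] times this expression is
   the integral of [t J_nu(t)^2]. *)
Definition lommel (nu x : R) : R :=
  let f := PSeries (bessel_coeff nu) x in
  let f1 := PSeries (PS_derive (bessel_coeff nu)) x in
  nu * f * f1 + x * f1 ^ 2 + f ^ 2 / 4.

(** Equivalent for [x > 0] to [(x^(nu+1) * lommel)' = x^nu f^2 / 4]. The form without powers also
    makes sense at 0, where it yields the initial value. *)
Lemma is_derive_lommel (nu x : R) : -1 < nu -> exists d,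
  is_derive (lommel nu) x d /\
  (nu + 1) * lommel nu x + x * d = PSeries (bessel_coeff nu) x ^ 2 / 4.
Proof.
  intros hnu.
  destruct (is_derive_entire _ x (entire_bessel_coeff nu hnu)) as [d1 d2].
  pose proof (bessel_ode nu x hnu) as ode; cbv zeta in ode.
  unfold lommel.
  set (f := PSeries (bessel_coeff nu)) in *.
  set (f1 := PSeries (PS_derive (bessel_coeff nu))) in *.
  set (f2 := PSeries (PS_derive (PS_derive (bessel_coeff nu)))) in *.
  exists (nu * (f1 x * f1 x + f x * f2 x) + (f1 x ^ 2 + x * (2 * f1 x * f2 x))
          + f x * f1 x / 2).
  split.
  - assert (x1 : ex_derive f x) by (eexists; exact d1).
    assert (x2 : ex_derive f1 x) by (eexists; exact d2).
    auto_derive; [tauto|].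
    change (fun x0 : R => f x0) with f; change (fun x0 : R => f1 x0) with f1.
    rewrite (is_derive_unique _ _ _ d1), (is_derive_unique _ _ _ d2); field.
  - assert (e : x * f2 x = - (nu + 1) * f1 x - f x / 4) by lra.
    transitivity ((nu + 1) * (nu * f x * f1 x + x * f1 x ^ 2 + f x ^ 2 / 4)
      + (nu * (x * f1 x ^ 2 + f x * (x * f2 x)) + x * f1 x ^ 2
         + 2 * x * f1 x * (x * f2 x) + x * f x * f1 x / 2)); [field|].
    rewrite e; field.
Qed.

(** [lommel] is [1 / (4 (nu+1))] at 0, hence positive at some small [y > 0]; from there the
    nondecreasing function [x^(nu+1) * lommel] carries the sign to [x]. *)
Lemma lommel_pos (nu x : R) : -1 < nu -> 0 < x -> 0 < lommel nu x.
Proof.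
  intros hnu hx.
  assert (h0 : 0 < lommel nu 0).
  { destruct (is_derive_lommel nu 0 hnu) as (d & _ & e).
    rewrite Rmult_0_l, Rplus_0_r, PSeries_0 in e.
    unfold bessel_coeff in e; simpl in e.
    replace (1 / (1 * 1 * 1)) with 1 in e by field.
    apply Rmult_lt_reg_l with (nu + 1); lra. }
  assert (hc : continuity_pt (lommel nu) 0).
  { destruct (is_derive_lommel nu 0 hnu) as (d & hd & _).
    apply derivable_continuous_pt; exists d; apply is_derive_Reals; exact hd. }
  destruct (hc (lommel nu 0) h0) as (delta & hdelta & hd).
  set (y := Rmin (delta / 2) (x / 2)).
  assert (hy : 0 < y /\ y < delta /\ y < x).
  { unfold y; pose proof (Rmin_l (delta / 2) (x / 2)); pose proof (Rmin_r (delta / 2) (x / 2)).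
    split; [apply Rmin_glb_lt|split]; lra. }
  assert (hly : 0 < lommel nu y).
  { specialize (hd y); simpl in hd; unfold Rdist in hd.
    assert (h : Rabs (lommel nu y - lommel nu 0) < lommel nu 0).
    { apply hd; split; [split; [exact I|lra]|].
      rewrite Rminus_0_r, Rabs_right; lra. }
    apply Rabs_def2 in h; lra. }
  set (h := fun t => exp ((nu + 1) * ln t) * lommel nu t).
  assert (hder : forall t, 0 < t -> exists d, is_derive h t d /\ 0 <= d).
  { intros t ht; destruct (is_derive_lommel nu t hnu) as (d & hd' & e).
    exists (exp ((nu + 1) * ln t) / t * (PSeries (bessel_coeff nu) t ^ 2 / 4)); split.
    - rewrite <- e; unfold h.
      assert (ex_derive (lommel nu) t) by (eexists; exact hd').
      auto_derive; [tauto|].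
      change (fun x0 : R => lommel nu x0) with (lommel nu).
      rewrite (is_derive_unique _ _ _ hd'); field; lra.
    - apply Rmult_le_pos; [apply Rdiv_le_0_compat; [apply Rlt_le, exp_pos|exact ht]|].
      pose proof (pow2_ge_0 (PSeries (bessel_coeff nu) t)); lra. }
  assert (hD : forall t, 0 < t -> is_derive h t (Derive h t) /\ 0 <= Derive h t).
  { intros t ht; destruct (hder t ht) as (d & h1 & h2).
    rewrite (is_derive_unique _ _ _ h1); now split. }
  destruct (MVT_gen h y x (Derive h)) as (c & hc1 & hc2).
  - intros t ht; apply hD; rewrite Rmin_left in ht by lra; lra.
  - intros t ht; rewrite Rmin_left in ht by lra.
    apply derivable_continuous_pt; exists (Derive h t); apply is_derive_Reals, hD; lra.
  - rewrite Rmin_left in hc1 by lra.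
    destruct (hD c ltac:(lra)) as [_ h2].
    assert (hh : h y <= h x).
    { assert (0 <= Derive h c * (x - y)) by (apply Rmult_le_pos; lra); lra. }
    unfold h in hh.
    assert (0 < exp ((nu + 1) * ln y) * lommel nu y)
      by (apply Rmult_lt_0_compat; [apply exp_pos|exact hly]).
    apply Rmult_lt_reg_l with (exp ((nu + 1) * ln x)); [apply exp_pos|lra].
Qed.

(** At a zero of [F = f + 2 x f'], the differential equation reduces [lommel] to [- (f/2) F'], so a
    vanishing derivative would contradict positivity. *)
Lemma dini_zero_simple (nu x : R) : -1 < nu -> 0 < x -> PSeries (dini_coeff nu) x = 0 ->
  exists d, is_derive (PSeries (dini_coeff nu)) x d /\ d <> 0.
Proof.
  intros hnu hx h0.
  destruct (is_derive_entire _ x (entire_bessel_coeff nu hnu)) as [d1 d2].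
  pose proof (lommel_pos nu x hnu hx) as hpos; unfold lommel in hpos; cbv zeta in hpos.
  pose proof (bessel_ode nu x hnu) as ode; cbv zeta in ode.
  rewrite dini_PSeries in h0 by exact hnu.
  set (f := PSeries (bessel_coeff nu)) in *.
  set (f1 := PSeries (PS_derive (bessel_coeff nu))) in *.
  set (f2 := PSeries (PS_derive (PS_derive (bessel_coeff nu)))) in *.
  exists (f1 x + 2 * (f1 x + x * f2 x)); split.
  - apply is_derive_ext with (fun t => f t + 2 * (t * f1 t)).
    { intros t; symmetry; now apply dini_PSeries. }
    assert (x1 : ex_derive f x) by (eexists; exact d1).
    assert (x2 : ex_derive f1 x) by (eexists; exact d2).
    auto_derive; [tauto|].
    change (fun x0 : R => f x0) with f; change (fun x0 : R => f1 x0) with f1.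
    rewrite (is_derive_unique _ _ _ d1), (is_derive_unique _ _ _ d2); ring.
  - intros hd.
    assert (e : x * f2 x = - (nu + 1) * f1 x - f x / 4) by lra.
    rewrite e in hd.
    assert (e2 : x * f1 x = - f x / 2) by lra.
    assert (nu * f x * f1 x + x * f1 x ^ 2 + f x ^ 2 / 4 = 0); [|lra].
    transitivity (nu * f x * f1 x + (x * f1 x) * f1 x + f x ^ 2 / 4); [ring|].
    rewrite e2.
    transitivity (- f x / 2 * (f1 x + 2 * (f1 x + (- (nu + 1) * f1 x - f x / 4)))); [field|].
    rewrite hd; ring.
Qed.

Lemma cser_RtoC (a : nat -> R) (x : R) : cser a (RtoC x) = RtoC (PSeries a x).
Proof.
  unfold cser, PSeries, RtoC at 3; f_equal.
  - apply Series_ext; intros k; now rewrite <- RtoC_pow.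
  - transitivity (Series (fun k => a k * 0)).
    + apply Series_ext; intros k; now rewrite <- RtoC_pow.
    + rewrite Series_scal_r; ring.
Qed.

(** * Identification of the zeros *)

Definition cprod_limit (x : nat -> R) (F : Complex.C -> Complex.C) : Prop :=
  forall r eps, 0 <= r -> 0 < eps -> exists K0, forall K w, (K0 <= K)%nat -> Cmod w <= r ->
  Cmod (cprod x K w - F w) <= eps.

Lemma rprod_limit (x : nat -> R) (F : Complex.C -> Complex.C) (G : R -> R) :
  (forall t, F (RtoC t) = RtoC (G t)) -> cprod_limit x F ->
  forall t eps, 0 < eps -> exists K0, forall K, (K0 <= K)%nat -> Rabs (rprod x K t - G t) <= eps.
Proof.
  intros hG h t eps he; destruct (h (Rabs t) eps (Rabs_pos t) he) as [K0 hK].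
  exists K0; intros K hKK; specialize (hK K (RtoC t) hKK).
  rewrite hG, cprod_RtoC, <- RtoC_minus, !Cmod_R in hK; apply hK; lra.
Qed.

Lemma rprod_limit_zero (x : nat -> R) (F : Complex.C -> Complex.C) (G : R -> R) (k : nat) :
  (forall t, F (RtoC t) = RtoC (G t)) -> cprod_limit x F -> 0 < x k -> G (/ x k) = 0.
Proof.
  intros hG h hk; apply Rabs_eq_0, Rle_antisym; [|apply Rabs_pos].
  apply le_epsilon; intros eps he.
  destruct (rprod_limit x F G hG h (/ x k) eps he) as [K0 hK].
  specialize (hK (K0 + S k)%nat ltac:(lia)).
  rewrite (rprod_zero x (K0 + S k) k) in hK by (try lia; field; lra).
  rewrite Rabs_minus_sym, Rminus_0_r in hK; lra.
Qed.

(** The Weierstrass inequality that a product of [1 - a_k] is at least one minus the sum of the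
    [a_k]; keeping that sum at most 1 makes the induction preserve the sign. *)
Lemma rprod_tail_ge (x : nat -> R) (r : R) (M K : nat) : (forall k, 0 <= x k) -> 0 <= r ->
  (forall k, (M <= k)%nat -> r * (psum x k - psum x M) <= 1) -> (M <= K)%nat ->
  Rabs (rprod x M r) * (1 - r * (psum x K - psum x M)) <= Rabs (rprod x K r).
Proof.
  intros hx hr ht hK; induction hK as [|K hK IH]; [lra|].
  simpl; rewrite Rabs_mult.
  pose proof (ht K hK) as h1; pose proof (psum_le x M K hx hK) as h2.
  pose proof (Rmult_le_pos _ _ hr (hx K)) as h3.
  pose proof (Rle_abs (1 - r * x K)) as h4.
  pose proof (Rabs_pos (rprod x M r)) as h5; pose proof (Rabs_pos (1 - r * x K)) as h6.
  assert (h7 : 0 <= r * (psum x K - psum x M)) by (apply Rmult_le_pos; lra).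
  set (T := r * (psum x K - psum x M)) in *.
  replace (r * (psum x K + x K - psum x M)) with (T + r * x K) by (unfold T; ring).
  apply Rle_trans with (Rabs (rprod x M r) * (1 - T) * Rabs (1 - r * x K)).
  - rewrite Rmult_assoc; apply Rmult_le_compat_l; [exact h5|].
    apply Rle_trans with ((1 - T) * (1 - r * x K)); [nra|].
    apply Rmult_le_compat_l; lra.
  - apply Rmult_le_compat_r; assumption.
Qed.

Lemma rprod_neq_0 (x : nat -> R) (M : nat) (r : R) :
  (forall k, r * x k <> 1) -> rprod x M r <> 0.
Proof.
  intros h; induction M as [|M IH]; simpl; [lra|].
  apply Rmult_integral_contrapositive_currified; [exact IH|specialize (h M); lra].
Qed.

(** An infinite product vanishes only through a factor: beyond a point where [r] times the tail is
    at most [1/2], the partial products keep at least half of a nonzero absolute value and cannot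
    tend to 0. *)
Lemma rprod_limit_factor (x : nat -> R) (F : Complex.C -> Complex.C) (G : R -> R) (r : R) :
  (forall t, F (RtoC t) = RtoC (G t)) -> cprod_limit x F -> (forall k, 0 <= x k) ->
  (forall eps, 0 < eps -> exists M, forall k, (M <= k)%nat -> psum x k - psum x M <= eps) ->
  0 < r -> G r = 0 -> exists k, r * x k = 1.
Proof.
  intros hG h hx ht hr h0; apply NNPP; intros hn.
  assert (hne : forall k, r * x k <> 1) by (intros k e; apply hn; now exists k).
  assert (hi : 0 < 1 / (2 * r)) by (apply Rdiv_lt_0_compat; lra).
  destruct (ht (1 / (2 * r)) hi) as [M hM].
  assert (hT : forall k, (M <= k)%nat -> r * (psum x k - psum x M) <= 1 / 2).
  { intros k hk; specialize (hM k hk).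
    apply Rmult_le_compat_l with (r := r) in hM; [|lra].
    replace (r * (1 / (2 * r))) with (1 / 2) in hM by (field; lra); exact hM. }
  pose proof (Rabs_pos_lt _ (rprod_neq_0 x M r hne)) as hp.
  destruct (rprod_limit x F G hG h r (Rabs (rprod x M r) / 4) ltac:(lra)) as [K0 hK].
  specialize (hK (K0 + M)%nat ltac:(lia)); rewrite h0, Rminus_0_r in hK.
  pose proof (rprod_tail_ge x r M (K0 + M) hx ltac:(lra)
    ltac:(intros k hk; specialize (hT k hk); lra) ltac:(lia)) as h1.
  specialize (hT (K0 + M)%nat ltac:(lia)); nra.
Qed.

Lemma quadratic_bound_derive (G : R -> R) (p B d : R) :
  (forall t, Rabs (t - p) <= 1 -> Rabs (G t) <= B * (t - p) ^ 2) -> is_derive G p d -> d = 0.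
Proof.
  intros hB hd; apply is_derive_Reals in hd.
  apply NNPP; intros hne; pose proof (Rabs_pos_lt _ hne) as hpos.
  assert (hG : G p = 0).
  { apply Rabs_eq_0, Rle_antisym; [|apply Rabs_pos].
    specialize (hB p); replace (p - p) with 0 in hB by ring.
    rewrite Rabs_R0 in hB; specialize (hB ltac:(lra)); simpl in hB; lra. }
  destruct (hd (Rabs d / 2) ltac:(lra)) as [delta hdel].
  pose proof (cond_pos delta) as hdp.
  pose proof (Rabs_pos B) as hBp.
  set (h := Rmin (Rmin 1 (delta / 2)) (Rabs d / (4 * (Rabs B + 1)))).
  assert (hq : 0 < Rabs d / (4 * (Rabs B + 1))) by (apply Rdiv_lt_0_compat; lra).
  assert (hh : 0 < h) by (unfold h; repeat apply Rmin_glb_lt; lra).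
  assert (h1 : h <= 1) by (unfold h; eapply Rle_trans; [apply Rmin_l|apply Rmin_l]).
  assert (h2 : h <= delta / 2) by (unfold h; eapply Rle_trans; [apply Rmin_l|apply Rmin_r]).
  assert (h3 : h * (4 * (Rabs B + 1)) <= Rabs d).
  { apply Rle_div_r; [lra|apply Rmin_r]. }
  specialize (hdel h ltac:(lra) ltac:(rewrite Rabs_right; lra)).
  specialize (hB (p + h)); replace (p + h - p) with h in hB by ring.
  rewrite (Rabs_right h) in hB by lra; specialize (hB h1).
  rewrite hG, Rminus_0_r in hdel.
  assert (h4 : Rabs (G (p + h) / h) <= Rabs B * h).
  { unfold Rdiv; rewrite Rabs_mult, Rabs_inv, (Rabs_right h) by lra.
    apply Rmult_le_reg_r with h; [exact hh|].
    rewrite Rmult_assoc, Rinv_l by lra; pose proof (Rle_abs B); nra. }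
  pose proof (Rabs_triang_inv d (G (p + h) / h)) as h5; rewrite Rabs_minus_sym in h5.
  nra.
Qed.

Lemma rprod_double_le (x : nat -> R) (k K : nat) (t r : R) : (forall k, 0 <= x k) ->
  x (S k) = x k -> Rabs t <= r -> (S (S k) <= K)%nat ->
  Rabs (rprod x K t) <= (1 - t * x k) ^ 2 * exp (r * psum x K).
Proof.
  intros hx he ht hK; induction hK as [|K hK IH].
  - simpl; rewrite he, !Rabs_mult.
    replace ((1 - t * x k) * ((1 - t * x k) * 1)) with (Rabs (1 - t * x k) * Rabs (1 - t * x k))
      by (rewrite <- Rabs_mult, Rabs_right; [ring|apply Rle_ge, Rle_0_sqr]).
    pose proof (Cmod_cprod_le x k (RtoC t) r hx ltac:(now rewrite Cmod_R)) as h.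
    rewrite cprod_RtoC, Cmod_R in h.
    rewrite Rmult_assoc, Rmult_comm.
    apply Rmult_le_compat_l; [apply Rmult_le_pos; apply Rabs_pos|].
    eapply Rle_trans; [exact h|]; apply exp_monotone.
    apply Rmult_le_compat_l; [pose proof (Rabs_pos t); lra|].
    pose proof (hx k); lra.
  - simpl rprod; simpl psum; rewrite Rabs_mult, Rmult_plus_distr_l, exp_plus, <- Rmult_assoc.
    apply Rmult_le_compat; [apply Rabs_pos..|exact IH|].
    pose proof (Cmod_one_minus_le (RtoC t) r (x K) ltac:(now rewrite Cmod_R) (hx K)) as h.
    rewrite <- RtoC_mult, <- RtoC_minus, Cmod_R in h; exact h.
Qed.

(** Two equal inverses put a squared factor into all later partial products, with cofactors bounded
    uniformly by [exp (r * A)]. The limit inherits a quadratic bound at the zero, hence a zero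
    derivative, without any convergence of derivatives. *)
Lemma simple_zeros_strict (x : nat -> R) (A : R) (F : Complex.C -> Complex.C) (G : R -> R) :
  (forall t, F (RtoC t) = RtoC (G t)) -> cprod_limit x F -> nonincreasing_nonneg x ->
  (forall k, psum x k <= A) ->
  (forall t, 0 < t -> G t = 0 -> exists d, is_derive G t d /\ d <> 0) ->
  forall k, 0 < x k -> x (S k) < x k.
Proof.
  intros hG h [hx hd] hA hsimple k hk.
  destruct (Rle_lt_or_eq_dec _ _ (hd k)) as [|e]; [assumption|exfalso].
  assert (hp : 0 < / x k) by now apply Rinv_0_lt_compat.
  destruct (hsimple (/ x k) hp (rprod_limit_zero x F G k hG h hk)) as (d & hder & hne).
  apply hne; set (r := / x k + 1).
  apply (quadratic_bound_derive G (/ x k) (x k ^ 2 * exp (r * A))); [|exact hder].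
  intros t ht.
  assert (htr : Rabs t <= r).
  { pose proof (Rabs_triang_inv t (/ x k)) as h1; rewrite (Rabs_right (/ x k)) in h1 by lra.
    unfold r; lra. }
  apply le_epsilon; intros eps he.
  destruct (rprod_limit x F G hG h t eps he) as [K0 hK].
  specialize (hK (K0 + S (S k))%nat ltac:(lia)).
  pose proof (rprod_double_le x k (K0 + S (S k)) t r hx e htr ltac:(lia)) as h1.
  rewrite Rabs_minus_sym in hK.
  pose proof (Rabs_triang_inv (G t) (rprod x (K0 + S (S k)) t)) as h2.
  assert (h3 : (1 - t * x k) ^ 2 * exp (r * psum x (K0 + S (S k)))
    <= x k ^ 2 * exp (r * A) * (t - / x k) ^ 2).
  { replace (x k ^ 2 * exp (r * A) * (t - / x k) ^ 2)
      with ((1 - t * x k) ^ 2 * exp (r * A)) by (field; lra).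
    apply Rmult_le_compat_l; [apply pow2_ge_0|]; apply exp_monotone.
    apply Rmult_le_compat_l; [unfold r; lra|apply hA]. }
  lra.
Qed.

Lemma increasing_index (g : nat -> nat) : (forall k, (g k < g (S k))%nat) ->
  forall k, (k <= g k)%nat.
Proof. intros h k; induction k as [|k IH]; [lia|]; specialize (h k); lia. Qed.

Lemma nonincreasing_chain (x : nat -> R) : (forall k, x (S k) <= x k) ->
  forall j k, (j <= k)%nat -> x k <= x j.
Proof. intros h j k hjk; induction hjk as [|k hjk IH]; [lra|]; specialize (h k); lra. Qed.

(** A priori [x] could reach 0 after finitely many terms, so strictness is available only at
    positive terms. That [b] is an infinite subsequence of [x] gives [b k <= x k], hence positivity
    throughout; then [x] is a subsequence of [b] and the reverse inequality follows. *)
Lemma same_enumeration (x b : nat -> R) : nonincreasing_nonneg x ->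
  (forall k, 0 < x k -> x (S k) < x k) ->
  (forall k, 0 < b k) -> (forall k, b (S k) < b k) ->
  (forall m, exists k, x k = b m) -> (forall k, 0 < x k -> exists m, x k = b m) ->
  forall k, x k = b k.
Proof.
  intros [hx hd] hstrict hb hbd h1 h2.
  pose proof (nonincreasing_chain x hd) as hxc.
  pose proof (nonincreasing_chain b (fun k => Rlt_le _ _ (hbd k))) as hbc.
  assert (hge : forall k, b k <= x k).
  { set (g := fun m => proj1_sig (constructive_indefinite_description _ (h1 m))).
    assert (hg : forall m, x (g m) = b m)
      by (intros m; exact (proj2_sig (constructive_indefinite_description _ (h1 m)))).
    intros k; rewrite <- hg; apply hxc, increasing_index; intros m.
    destruct (Nat.lt_ge_cases (g m) (g (S m))) as [|hle]; [assumption|].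
    apply hxc in hle; rewrite !hg in hle; specialize (hbd m); lra. }
  assert (hpos : forall k, 0 < x k) by (intros k; specialize (hge k); specialize (hb k); lra).
  set (g := fun k => proj1_sig (constructive_indefinite_description _ (h2 k (hpos k)))).
  assert (hg : forall k, x k = b (g k))
    by (intros k; exact (proj2_sig (constructive_indefinite_description _ (h2 k (hpos k))))).
  intros k; apply Rle_antisym; [|apply hge].
  rewrite hg; apply hbc, increasing_index; intros m.
  destruct (Nat.lt_ge_cases (g m) (g (S m))) as [|hle]; [assumption|].
  apply hbc in hle; rewrite <- !hg in hle; specialize (hstrict m (hpos m)); lra.
Qed.

Lemma dini_hadamard (nu : R) (alpha : nat -> R) : -1 < nu ->
  (forall n, 0 < alpha n) -> (forall n, alpha n < alpha (S n)) ->
  (forall n, PSeries (dini_coeff nu) (alpha n ^ 2) = 0) ->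
  (forall r, 0 < r -> PSeries (dini_coeff nu) (r ^ 2) = 0 -> exists n, alpha n = r) ->
  exists x, (forall n, x n = / alpha n ^ 2) /\ cprod_limit x (cser (dini_coeff nu)).
Proof.
  intros hnu hpos hinc hzero hall.
  destruct (dini_product nu hnu) as (x & A & hx & hA & ht & hlim).
  exists x; split; [|exact hlim].
  pose proof (cser_RtoC (dini_coeff nu)) as hG.
  apply same_enumeration.
  - exact hx.
  - apply (simple_zeros_strict x A _ _ hG hlim hx hA).
    intros t; now apply dini_zero_simple.
  - intros k; apply Rinv_0_lt_compat, pow_lt, hpos.
  - intros k; pose proof (hpos k); pose proof (hpos (S k)); pose proof (hinc k).
    apply Rinv_lt_contravar; [apply Rmult_lt_0_compat; apply pow_lt; assumption|nra].
  - intros m; pose proof (pow_lt _ 2 (hpos m)) as hp.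
    destruct (rprod_limit_factor x _ _ (alpha m ^ 2) hG hlim (proj1 hx) ht hp (hzero m)) as [k e].
    exists k; apply Rmult_eq_reg_l with (alpha m ^ 2); [|lra].
    rewrite Rinv_r by lra; exact e.
  - intros k hk.
    assert (hp : 0 < / x k) by now apply Rinv_0_lt_compat.
    pose proof (sqrt_lt_R0 _ hp) as hs.
    pose proof (pow2_sqrt (/ x k) ltac:(lra)) as e.
    destruct (hall (sqrt (/ x k)) hs) as [m hm].
    + rewrite e; exact (rprod_limit_zero x _ _ k hG hlim hk).
    + exists m; rewrite hm, e, Rinv_inv; reflexivity.
Qed.

Require Import Defs.

(** * The Gamma function *)

Definition euler (x : R) (n : nat) : R :=
  INR (fact n) * Rpower (INR n) x / prod_f_R0 (fun k => x + INR k) n.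

Lemma ln_le_pred (y : R) : 0 < y -> ln y <= y - 1.
Proof.
  intros hy; rewrite <- (ln_exp (y - 1)); apply Rcomplements.ln_le; [exact hy|].
  pose proof (exp_ineq1_le (y - 1)); lra.
Qed.

Lemma ln_ge_one_minus_inv (y : R) : 0 < y -> 1 - / y <= ln y.
Proof.
  intros hy; pose proof (ln_le_pred (/ y) (Rinv_0_lt_compat _ hy)) as h.
  rewrite ln_Rinv in h by exact hy; lra.
Qed.

Lemma prod_euler_pos (x : R) (n : nat) : 0 < x -> 0 < prod_f_R0 (fun k => x + INR k) n.
Proof.
  intros hx; induction n as [|n IH]; cbn [prod_f_R0]; [change (0 < x + 0); lra|].
  apply Rmult_lt_0_compat; [exact IH|]; pose proof (pos_INR (S n)); lra.
Qed.

Lemma euler_pos (x : R) (n : nat) : 0 < x -> 0 < euler x n.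
Proof.
  intros hx; apply Rdiv_lt_0_compat; [|now apply prod_euler_pos].
  apply Rmult_lt_0_compat; [apply INR_fact_lt_0|apply exp_pos].
Qed.

(** The increment is [x ln(1 + 1/n) - ln(1 + x/(n+1))]. The bounds [1 - 1/y <= ln y <= y - 1] show
    that it is nonnegative and dominated by a telescoping difference, so the logarithms increase and
    stay bounded. *)
Lemma ln_euler_succ (x : R) (n : nat) : 0 < x -> (0 < n)%nat ->
  0 <= ln (euler x (S n)) - ln (euler x n)
    <= x * (x + 1) / INR n - x * (x + 1) / INR (S n).
Proof.
  intros hx hn; pose proof (lt_0_INR n hn) as hm; set (m := INR n) in *.
  assert (e : euler x (S n) = euler x n * (Rpower ((m + 1) / m) x * / ((x + m + 1) / (m + 1)))).
  { unfold euler; rewrite fact_simpl, mult_INR, !S_INR.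
    cbn [prod_f_R0]; rewrite S_INR; fold m.
    replace (Rpower (m + 1) x) with (Rpower m x * Rpower ((m + 1) / m) x).
    - pose proof (prod_euler_pos x n hx); field; repeat split; lra.
    - rewrite Rpower_mult_distr by (try apply Rdiv_lt_0_compat; lra).
      f_equal; field; lra. }
  assert (hq : 0 < (m + 1) / m) by (apply Rdiv_lt_0_compat; lra).
  assert (hs : 0 < (x + m + 1) / (m + 1)) by (apply Rdiv_lt_0_compat; lra).
  rewrite e, ln_mult, ln_mult, ln_Rinv; try assumption.
  2: apply exp_pos.
  2: now apply Rinv_0_lt_compat.
  2: now apply euler_pos.
  2: apply Rmult_lt_0_compat; [apply exp_pos|now apply Rinv_0_lt_compat].
  unfold Rpower; rewrite ln_exp, S_INR; fold m.
  pose proof (ln_le_pred _ hq) as a1; pose proof (ln_ge_one_minus_inv _ hq) as a2.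
  pose proof (ln_le_pred _ hs) as b1; pose proof (ln_ge_one_minus_inv _ hs) as b2.
  replace ((m + 1) / m - 1) with (/ m) in a1 by (field; lra).
  replace (1 - / ((m + 1) / m)) with (/ (m + 1)) in a2 by (field; lra).
  replace ((x + m + 1) / (m + 1) - 1) with (x * / (m + 1)) in b1 by (field; lra).
  replace (1 - / ((x + m + 1) / (m + 1))) with (x * / (x + m + 1)) in b2 by (field; lra).
  split.
  - assert (x * / (m + 1) <= x * ln ((m + 1) / m)) by (apply Rmult_le_compat_l; lra); lra.
  - assert (h1 : x * ln ((m + 1) / m) <= x * / m) by (apply Rmult_le_compat_l; lra).
    assert (h2 : x * / m - x * / (x + m + 1) <= x * (x + 1) / m - x * (x + 1) / (m + 1)).
    { replace (x * / m - x * / (x + m + 1)) with (x * (x + 1) / m * / (x + m + 1))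
        by (field; lra).
      replace (x * (x + 1) / m - x * (x + 1) / (m + 1)) with (x * (x + 1) / m * / (m + 1))
        by (field; lra).
      apply Rmult_le_compat_l.
      - apply Rdiv_le_0_compat; [apply Rmult_le_pos|]; lra.
      - apply Rinv_le_contravar; lra. }
    lra.
Qed.

Lemma euler_cv (x : R) : 0 < x -> exists l, 0 < l /\ Un_cv (euler x) l.
Proof.
  (* The shift skips index 0, where [Rpower (INR 0) x] is a default value. *)
  intros hx; set (L := fun n => ln (euler x (S n))).
  assert (hL : ex_finite_lim_seq L).
  { apply ex_finite_lim_seq_incr with (L O + x * (x + 1)).
    - intros n; pose proof (ln_euler_succ x (S n) hx ltac:(lia)); unfold L; lra.
    - assert (hb : forall n, L n <= L O + x * (x + 1) - x * (x + 1) / INR (S n)).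
      { induction n as [|n IH]; [simpl; lra|].
        pose proof (ln_euler_succ x (S n) hx ltac:(lia)); unfold L in *; lra. }
      intros n; specialize (hb n).
      assert (0 <= x * (x + 1) / INR (S n)); [|lra].
      apply Rdiv_le_0_compat; [apply Rmult_le_pos; lra|apply lt_0_INR; lia]. }
  destruct hL as [l hl]; exists (exp l); split; [apply exp_pos|].
  apply is_lim_seq_Reals, is_lim_seq_incr_1.
  apply is_lim_seq_ext with (fun n => exp (L n)).
  - intros n; unfold L; apply exp_ln, euler_pos, hx.
  - apply is_lim_seq_continuous; [|exact hl].
    apply derivable_continuous_pt, derivable_pt_exp.
Qed.

Lemma Gamma_cv (x : R) : 0 < x -> Un_cv (euler x) (Gamma x) /\ 0 < Gamma x.
Proof.
  intros hx; destruct (euler_cv x hx) as (l & hl & hcv).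
  assert (hG : Un_cv (euler x) (Gamma x)).
  { unfold Gamma; apply (epsilon_spec (inhabits 0) (Un_cv (euler x))); now exists l. }
  split; [exact hG|]; rewrite (UL_sequence _ _ _ hG hcv); exact hl.
Qed.

(** The ratio [x n / (x + 1 + n)], written so that its limit [x] is visible; this yields the
    functional equation. *)
Lemma euler_shift (x : R) (n : nat) : 0 < x -> (0 < n)%nat ->
  euler (x + 1) n = euler x n * (x - x * (x + 1) * / (x + 1 + INR n)).
Proof.
  intros hx hn; pose proof (lt_0_INR n hn) as hm.
  assert (e : x * prod_f_R0 (fun k => x + 1 + INR k) n
    = prod_f_R0 (fun k => x + INR k) n * (x + 1 + INR n)).
  { clear hn hm; induction n as [|n IH]; [simpl; ring|].
    cbn [prod_f_R0]; rewrite <- Rmult_assoc, IH, S_INR; ring. }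
  unfold euler; rewrite Rpower_plus, Rpower_1 by exact hm.
  pose proof (prod_euler_pos x n hx) as p1.
  pose proof (prod_euler_pos (x + 1) n ltac:(lra)) as p2.
  set (Q := prod_f_R0 (fun k => x + INR k) n) in *.
  set (Q' := prod_f_R0 (fun k => x + 1 + INR k) n) in *.
  replace Q with (x * Q' / (x + 1 + INR n)) by (rewrite e; field; lra).
  field; repeat split; lra.
Qed.

Lemma Gamma_succ (x : R) : 0 < x -> Gamma (x + 1) = x * Gamma x.
Proof.
  intros hx.
  destruct (Gamma_cv x hx) as [h1 _]; destruct (Gamma_cv (x + 1) ltac:(lra)) as [h2 _].
  apply is_lim_seq_Reals in h1; apply is_lim_seq_Reals in h2.
  assert (h3 : is_lim_seq (fun n => x - x * (x + 1) * / (x + 1 + INR n)) x).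
  { replace (Finite x) with (Finite (x - x * (x + 1) * 0)) by (f_equal; ring).
    apply is_lim_seq_minus'; [apply is_lim_seq_const|].
    apply is_lim_seq_mult'; [apply is_lim_seq_const|].
    replace (Finite 0) with (Rbar_inv p_infty) by reflexivity.
    apply is_lim_seq_inv; [|discriminate].
    apply is_lim_seq_plus with (x + 1) p_infty;
      [apply is_lim_seq_const|apply is_lim_seq_INR|reflexivity]. }
  pose proof (is_lim_seq_mult' _ _ _ _ h1 h3) as h4.
  assert (h5 : is_lim_seq (euler (x + 1)) (Gamma x * x)).
  { apply is_lim_seq_incr_1; apply is_lim_seq_incr_1 in h4.
    eapply is_lim_seq_ext; [|exact h4].
    intros n; symmetry; apply euler_shift; [exact hx|lia]. }
  apply is_lim_seq_unique in h2; apply is_lim_seq_unique in h5.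
  rewrite h2 in h5; injection h5; lra.
Qed.

Lemma Gamma_poch (nu : R) (n : nat) : -1 < nu ->
  Gamma (INR n + nu + 1) = poch nu n * Gamma (nu + 1).
Proof.
  intros hnu; induction n as [|n IH].
  - simpl; rewrite Rmult_1_l; f_equal; ring.
  - rewrite S_INR; replace (INR n + 1 + nu + 1) with (INR n + nu + 1 + 1) by ring.
    pose proof (pos_INR n); rewrite Gamma_succ, IH by lra; simpl poch; ring.
Qed.

(** * Complex powers *)

Lemma Cminus_eq_0 (a b : Complex.C) : (a - b)%C = Complex.RtoC 0 -> a = b.
Proof. intros h; replace a with ((a - b) + b)%C by ring; rewrite h; ring. Qed.

(* [Cx] is convertible to Coquelicot's type of complex numbers, but the field structure is
   declared on the latter only; moving the goal to [a - b = 0] makes it visible to [ring]. *)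
Ltac cring := apply Cminus_eq_0; ring.
Ltac cfield := apply Cminus_eq_0; field.

Lemma Cnorm_pos (z : Cx) : z <> C0 -> 0 < Cnorm z.
Proof. intros h; apply (proj1 (Cmod_gt_0 z)), h. Qed.

Lemma sqrt_1_sqr_div (x y : R) : x <> 0 -> sqrt (1 + (y / x)²) = sqrt (x ^ 2 + y ^ 2) / Rabs x.
Proof.
  intros hx; replace (1 + (y / x)²) with ((x ^ 2 + y ^ 2) / x ^ 2) by (unfold Rsqr; field; lra).
  pose proof (pow2_ge_0 x); pose proof (pow2_ge_0 y).
  assert (0 < x ^ 2) by (apply pow2_gt_0, hx).
  rewrite sqrt_div by lra; f_equal.
  replace (x ^ 2) with (x²) by (unfold Rsqr; ring); apply sqrt_Rsqr_abs.
Qed.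

Lemma Carg_polar (z : Cx) : z <> C0 ->
  Cnorm z * cos (Carg z) = fst z /\ Cnorm z * sin (Carg z) = snd z.
Proof.
  intros hz; pose proof (Cnorm_pos z hz) as hn; destruct z as [x y].
  unfold Carg, Cnorm in *; simpl fst in *; simpl snd in *.
  destruct (Rlt_dec 0 x) as [hx|hx]; [|destruct (Rlt_dec x 0) as [hx'|hx']].
  - rewrite cos_atan, sin_atan, sqrt_1_sqr_div, Rabs_right by lra.
    split; field; lra.
  - assert (e : cos (atan (y / x)) * sqrt (x ^ 2 + y ^ 2) = - x
      /\ sin (atan (y / x)) * sqrt (x ^ 2 + y ^ 2) = - y).
    { rewrite cos_atan, sin_atan, sqrt_1_sqr_div, Rabs_left by lra.
      split; field; lra. }
    destruct (Rle_dec 0 y).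
    + rewrite neg_cos, neg_sin; lra.
    + unfold Rminus; rewrite cos_plus, sin_plus, cos_neg, sin_neg, cos_PI, sin_PI; lra.
  - assert (x = 0) by lra; subst x.
    replace (0 ^ 2 + y ^ 2) with (y²) in * by (unfold Rsqr; ring).
    rewrite sqrt_Rsqr_abs in *.
    destruct (Rlt_dec 0 y) as [hy|hy]; [|destruct (Rlt_dec y 0) as [hy'|hy']].
    + rewrite cos_PI2, sin_PI2, Rabs_right by lra; lra.
    + rewrite cos_neg, sin_neg, cos_PI2, sin_PI2, Rabs_left by lra; lra.
    + exfalso; apply hz; assert (y = 0) by lra; subst y; reflexivity.
Qed.

Lemma cpow_polar (z : Cx) (a : R) : z <> C0 ->
  cpow z a = (exp (a * ln (Cnorm z)) * cos (a * Carg z), exp (a * ln (Cnorm z)) * sin (a * Carg z)).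
Proof.
  intros hz; unfold cpow; destruct (Req_EM_T (fst z) 0) as [h1|]; [|reflexivity].
  destruct (Req_EM_T (snd z) 0) as [h2|]; [|reflexivity].
  exfalso; apply hz; destruct z; simpl in *; now subst.
Qed.

(** The base is fixed and one value of the argument serves both powers, so no branch jump can
    occur. *)
Lemma cpow_succ (z : Cx) (a : R) : z <> C0 -> cpow z (a + 1) = (z * cpow z a)%C.
Proof.
  intros hz; rewrite !cpow_polar by exact hz.
  destruct (Carg_polar z hz) as [h1 h2].
  unfold Complex.Cmult; simpl fst; simpl snd; rewrite <- h1, <- h2.
  rewrite !Rmult_plus_distr_r, !Rmult_1_l, cos_plus, sin_plus, exp_plus, exp_ln
    by now apply Cnorm_pos.
  f_equal; ring.
Qed.

Lemma cpow_neq_0 (z : Cx) (a : R) : z <> C0 -> cpow z a <> C0.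
Proof.
  intros hz e; rewrite cpow_polar in e by exact hz; injection e as e1 e2.
  pose proof (exp_pos (a * ln (Cnorm z))) as hp.
  apply Rmult_integral in e1; apply Rmult_integral in e2.
  pose proof (sin2_cos2 (a * Carg z)) as h; unfold Rsqr in h.
  destruct e1 as [|e1]; [lra|]; destruct e2 as [|e2]; [lra|].
  rewrite e1, e2 in h; lra.
Qed.

Lemma cpow_even (z : Cx) (nu : R) (n : nat) : z <> C0 \/ 0 <= nu ->
  cpow z (2 * INR n + nu) = (cpow z nu * (z * z) ^ n)%C.
Proof.
  intros hz; destruct (excluded_middle_informative (z = C0)) as [e|hz0].
  - destruct hz as [hz|hnu]; [contradiction|]; subst z.
    destruct n as [|n].
    + replace (2 * INR 0 + nu) with nu by (simpl; ring).
      change ((C0 * C0) ^ 0)%C with (Complex.RtoC 1); cring.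
    + transitivity C0.
      * unfold cpow, C0; simpl fst; simpl snd.
        destruct (Req_EM_T 0 0) as [_|h]; [|lra].
        destruct (Req_EM_T (2 * INR (S n) + nu) 0) as [h|_]; [|reflexivity].
        pose proof (lt_0_INR (S n) ltac:(lia)); lra.
      * rewrite Cpow_S; change C0 with (Complex.RtoC 0); cring.
  - clear hz; induction n as [|n IH].
    + replace (2 * INR 0 + nu) with nu by (simpl; ring).
      change ((z * z) ^ 0)%C with (Complex.RtoC 1); cring.
    + replace (2 * INR (S n) + nu) with (2 * INR n + nu + 1 + 1) by (rewrite S_INR; ring).
      rewrite !cpow_succ, IH, Cpow_S by exact hz0; cring.
Qed.

(** * Bessel and Dini functions as entire series *)

Definition climit (u : nat -> Complex.C) (l : Complex.C) : Prop :=
  forall eps, 0 < eps -> exists N0, forall N, (N0 <= N)%nat -> Cmod (u N - l) < eps.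

Lemma climit_unique (u : nat -> Complex.C) (l m : Complex.C) :
  climit u l -> climit u m -> l = m.
Proof.
  intros h1 h2.
  assert (h : Cmod (l - m) = 0).
  { apply Rle_antisym; [|apply Cmod_ge_0]; apply le_epsilon; intros eps he.
    destruct (h1 (eps / 2) ltac:(lra)) as [n1 k1]; destruct (h2 (eps / 2) ltac:(lra)) as [n2 k2].
    specialize (k1 (n1 + n2)%nat ltac:(lia)); specialize (k2 (n1 + n2)%nat ltac:(lia)).
    pose proof (Cmod_minus_triangle l (u (n1 + n2)%nat) m).
    rewrite <- Cmod_opp in k1.
    replace (- (u (n1 + n2)%nat - l))%C with (l - u (n1 + n2)%nat)%C in k1 by ring; lra. }
  apply Cmod_eq_0 in h.
  replace l with ((l - m) + m)%C by ring; rewrite h; ring.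
Qed.

Lemma climit_scal (c : Complex.C) (u : nat -> Complex.C) (l : Complex.C) :
  climit u l -> climit (fun n => c * u n)%C (c * l)%C.
Proof.
  intros h eps he; pose proof (Cmod_ge_0 c).
  destruct (h (eps / (Cmod c + 1))) as [N0 hN]; [apply Rdiv_lt_0_compat; lra|].
  exists N0; intros N hNN; specialize (hN N hNN).
  replace (c * u N - c * l)%C with (c * (u N - l))%C by ring; rewrite Cmod_mult.
  apply Rlt_div_r in hN; [|lra]; pose proof (Cmod_ge_0 (u N - l)%C); nra.
Qed.

Lemma climit_plus (u v : nat -> Complex.C) (l m : Complex.C) :
  climit u l -> climit v m -> climit (fun n => u n + v n)%C (l + m)%C.
Proof.
  intros h1 h2 eps he.
  destruct (h1 (eps / 2) ltac:(lra)) as [n1 k1]; destruct (h2 (eps / 2) ltac:(lra)) as [n2 k2].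
  exists (n1 + n2)%nat; intros N hN.
  specialize (k1 N ltac:(lia)); specialize (k2 N ltac:(lia)).
  replace (u N + v N - (l + m))%C with ((u N - l) + (v N - m))%C by ring.
  eapply Rle_lt_trans; [apply Cmod_triangle|lra].
Qed.

Lemma climit_ext (u v : nat -> Complex.C) (l : Complex.C) :
  (forall n, u n = v n) -> climit u l -> climit v l.
Proof.
  intros e h eps he; destruct (h eps he) as [N0 hN]; exists N0; intros N hNN.
  rewrite <- e; now apply hN.
Qed.

Lemma Csum_eq (f : nat -> Cx) (l : Cx) : climit (Cpartial f) l -> Csum f = l.
Proof.
  intros h; apply (climit_unique (Cpartial f)); [|exact h].
  unfold Csum; apply (epsilon_spec (inhabits C0) (Cseries_lim f)); exists l; exact h.
Qed.

Lemma Csum_cser (f : nat -> Cx) (a : nat -> R) (c w : Complex.C) : entire a ->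
  (forall n, f n = (c * (a n * w ^ n))%C) -> Csum f = (c * cser a w)%C.
Proof.
  intros ha hf; apply Csum_eq.
  apply climit_ext with (fun n => c * csum a n w)%C.
  - induction n as [|n IH]; [change (c * 0 = 0)%C; ring|].
    change (Cpartial f (S n)) with (Cpartial f n + f n)%C.
    rewrite <- IH, hf; simpl; ring.
  - apply climit_scal; intros eps he; now apply csum_cv.
Qed.

Definition dini_factor (nu : R) (z : Cx) : Complex.C :=
  Cdiv (cpow z nu) (RtoC (Rpower 2 nu * Gamma (nu + 1))).

Lemma dini_denominator_pos (nu : R) : -1 < nu -> 0 < Rpower 2 nu * Gamma (nu + 1).
Proof.
  intros hnu; apply Rmult_lt_0_compat; [apply exp_pos|].
  apply Gamma_cv; lra.
Qed.

Lemma bessel_term (nu : R) (n : nat) : -1 < nu ->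
  (-1) ^ n / (Rpower 2 (2 * INR n + nu) * INR (fact n) * Gamma (INR n + nu + 1))
  = / (Rpower 2 nu * Gamma (nu + 1)) * bessel_coeff nu n.
Proof.
  intros hnu; rewrite Gamma_poch by exact hnu; unfold bessel_coeff.
  assert (e : Rpower 2 (2 * INR n + nu) = 4 ^ n * Rpower 2 nu).
  { rewrite Rpower_plus; f_equal.
    replace (2 * INR n) with (INR (2 * n)) by (rewrite mult_INR; simpl; ring).
    rewrite Rpower_pow, pow_mult by lra; f_equal; simpl; ring. }
  rewrite e; pose proof (exp_pos (nu * ln 2)) as hp; fold (Rpower 2 nu) in hp.
  destruct (Gamma_cv (nu + 1) ltac:(lra)) as [_ hG].
  pose proof (poch_pos nu n hnu); pose proof (INR_fact_lt_0 n); pose proof (pow_lt 4 n ltac:(lra)).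
  field; repeat split; lra.
Qed.

Lemma dini_factor_eq (nu : R) (z : Cx) : -1 < nu ->
  dini_factor nu z = (cpow z nu * Complex.RtoC (/ (Rpower 2 nu * Gamma (nu + 1))))%C.
Proof.
  intros hnu; pose proof (dini_denominator_pos nu hnu).
  rewrite RtoC_inv by lra; reflexivity.
Qed.

Lemma BesselJ_cser (nu : R) (z : Cx) : -1 < nu -> z <> C0 \/ 0 <= nu ->
  BesselJ nu z = (dini_factor nu z * cser (bessel_coeff nu) (z * z))%C.
Proof.
  intros hnu hz; apply Csum_cser; [now apply entire_bessel_coeff|].
  intros n; rewrite bessel_term, cpow_even, dini_factor_eq by assumption.
  change (Complex.RtoC (/ (Rpower 2 nu * Gamma (nu + 1)) * bessel_coeff nu n)
    * (cpow z nu * (z * z) ^ n)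
    = cpow z nu * Complex.RtoC (/ (Rpower 2 nu * Gamma (nu + 1)))
      * (bessel_coeff nu n * (z * z) ^ n))%C.
  rewrite RtoC_mult; cring.
Qed.

(** The coefficients of [z J_nu'(z)]: multiplying by [z] restores the exponent [2k + nu], so the
    common factor is the same as for [J_nu]. *)
Definition bessel'_coeff (nu : R) (k : nat) : R := (2 * INR k + nu) * bessel_coeff nu k.

Lemma entire_bessel'_coeff (nu : R) : -1 < nu -> entire (bessel'_coeff nu).
Proof.
  intros hnu eps he.
  pose proof (entire_bessel_coeff nu hnu) as h0; pose proof (entire_INR _ h0) as h1.
  destruct (h0 eps he) as (C & hC & k0); destruct (h1 eps he) as (D & hD & k1).
  exists (2 * D + Rabs nu * C); split.
  - pose proof (Rabs_pos nu); nra.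
  - intros k; unfold bessel'_coeff; specialize (k0 k); specialize (k1 k).
    replace ((2 * INR k + nu) * bessel_coeff nu k)
      with (2 * (INR k * bessel_coeff nu k) + nu * bessel_coeff nu k) by ring.
    eapply Rle_trans; [apply Rabs_triang|].
    rewrite (Rabs_mult 2), (Rabs_mult nu), (Rabs_right 2) by lra.
    pose proof (Rabs_pos nu); nra.
Qed.

Lemma BesselJ'_cser (nu : R) (z : Cx) : -1 < nu -> z <> C0 ->
  (z * BesselJ' nu z)%C = (dini_factor nu z * cser (bessel'_coeff nu) (z * z))%C.
Proof.
  intros hnu hz.
  assert (e : BesselJ' nu z = (dini_factor nu z / z * cser (bessel'_coeff nu) (z * z))%C).
  { apply Csum_cser; [now apply entire_bessel'_coeff|].
    intros n.
    assert (ec : cpow z (2 * INR n + nu - 1) = (cpow z nu * (z * z) ^ n / z)%C).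
    { rewrite <- cpow_even by now left.
      replace (2 * INR n + nu) with (2 * INR n + nu - 1 + 1) at 2 by ring.
      rewrite cpow_succ by exact hz; cfield; exact hz. }
    rewrite ec, dini_factor_eq by exact hnu.
    replace ((-1) ^ n * (2 * INR n + nu)
      / (Rpower 2 (2 * INR n + nu) * INR (fact n) * Gamma (INR n + nu + 1)))
      with (/ (Rpower 2 nu * Gamma (nu + 1)) * bessel'_coeff nu n)
      by (unfold bessel'_coeff; rewrite Rmult_comm, Rmult_assoc, (Rmult_comm (bessel_coeff nu n)),
            <- bessel_term by exact hnu; unfold Rdiv; ring).
    change (Complex.RtoC (/ (Rpower 2 nu * Gamma (nu + 1)) * bessel'_coeff nu n)
      * (cpow z nu * (z * z) ^ n / z)
      = cpow z nu * Complex.RtoC (/ (Rpower 2 nu * Gamma (nu + 1))) / z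
        * (bessel'_coeff nu n * (z * z) ^ n))%C.
    rewrite RtoC_mult; cfield; exact hz. }
  rewrite e; cfield; exact hz.
Qed.

Lemma cser_dini (nu : R) (w : Complex.C) : -1 < nu ->
  cser (dini_coeff nu) w
  = (Complex.RtoC (1 - nu) * cser (bessel_coeff nu) w + cser (bessel'_coeff nu) w)%C.
Proof.
  intros hnu; apply (climit_unique (fun n => csum (dini_coeff nu) n w)).
  - intros eps he; apply csum_cv; [now apply entire_dini_coeff|exact he].
  - apply climit_ext with
      (fun n => Complex.RtoC (1 - nu) * csum (bessel_coeff nu) n w + csum (bessel'_coeff nu) n w)%C.
    + induction n as [|n IH]; simpl; [ring|].
      rewrite <- IH; unfold dini_coeff, bessel'_coeff.
      replace ((2 * INR n + 1) * bessel_coeff nu n)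
        with ((1 - nu) * bessel_coeff nu n + (2 * INR n + nu) * bessel_coeff nu n) by ring.
      rewrite RtoC_plus, !RtoC_mult; ring.
    + apply climit_plus; [apply climit_scal|]; intros eps he; apply csum_cv; try exact he;
        [now apply entire_bessel_coeff|now apply entire_bessel'_coeff].
Qed.

Lemma dini_cser (nu : R) (z : Cx) : -1 < nu -> z <> C0 \/ 0 <= nu ->
  dini nu z = (dini_factor nu z * cser (dini_coeff nu) (z * z))%C.
Proof.
  intros hnu hz.
  change (dini nu z) with (Complex.RtoC (1 - nu) * BesselJ nu z + z * BesselJ' nu z)%C.
  rewrite BesselJ_cser by assumption.
  destruct (excluded_middle_informative (z = C0)) as [e|hz0].
  - destruct hz as [hz|h0]; [contradiction|]; subst z.
    change C0 with (Complex.RtoC 0).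
    replace (0 * 0)%C with (Complex.RtoC 0) by ring.
    rewrite !cser_RtoC, !PSeries_0.
    replace (dini_coeff nu 0) with (bessel_coeff nu 0) by (unfold dini_coeff; simpl; ring).
    (* At the origin the derivative term is multiplied by 0, and [(1 - nu)] must act as 1 on the
       factor: either [nu = 0], or [0^nu = 0] by the convention in [cpow]. *)
    assert (h : (Complex.RtoC nu * dini_factor nu (Complex.RtoC 0))%C = Complex.RtoC 0).
    { rewrite dini_factor_eq by exact hnu.
      destruct (Req_dec nu 0) as [->|hne]; [ring|].
      assert (hc : cpow (Complex.RtoC 0) nu = Complex.RtoC 0).
      { unfold cpow; simpl fst; simpl snd.
        destruct (Req_EM_T 0 0); [|lra]; destruct (Req_EM_T nu 0); [lra|reflexivity]. }
      rewrite hc; ring. }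
    rewrite RtoC_minus.
    transitivity (dini_factor nu (Complex.RtoC 0) * bessel_coeff nu 0
      - Complex.RtoC nu * dini_factor nu (Complex.RtoC 0) * bessel_coeff nu 0)%C; [cring|].
    rewrite h; cring.
  - rewrite BesselJ'_cser, cser_dini by assumption; cring.
Qed.

Lemma dini_real_zero (nu r : R) : -1 < nu -> 0 < r ->
  dini nu (RtoC r) = C0 <-> PSeries (dini_coeff nu) (r ^ 2) = 0.
Proof.
  intros hnu hr.
  assert (hz : RtoC r <> C0) by (intros e; injection e; lra).
  assert (e : (RtoC r * RtoC r)%C = Complex.RtoC (r ^ 2)).
  { change (RtoC r) with (Complex.RtoC r); rewrite <- RtoC_mult; f_equal; ring. }
  rewrite dini_cser, e, cser_RtoC by (try left; assumption).
  split.
  - intros h; apply NNPP; intros hne.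
    assert (h1 : Complex.RtoC (PSeries (dini_coeff nu) (r ^ 2)) <> Complex.RtoC 0)
      by (intros E; apply RtoC_inj in E; contradiction).
    pose proof (dini_denominator_pos nu hnu) as hd.
    assert (h2 : dini_factor nu (RtoC r) <> Complex.RtoC 0).
    { rewrite dini_factor_eq by exact hnu; apply Cmult_neq_0; [now apply cpow_neq_0|].
      intros E; apply RtoC_inj in E; pose proof (Rinv_0_lt_compat _ hd); lra. }
    exact (Cmult_neq_0 _ _ h2 h1 h).
  - intros ->; change C0 with (Complex.RtoC 0); cring.
Qed.

(** * Compact sets and the product formula *)

Lemma Ccompact_bounded (K : Cx -> Prop) : Ccompact K ->
  exists B, 0 <= B /\ forall z, K z -> Cnorm z <= B.
Proof.
  intros hK; destruct (hK nat (fun n z => Cnorm z < INR n)) as [l hl].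
  - intros n z hz; exists (INR n - Cnorm z); split; [lra|].
    intros w hw.
    assert (h : Cmod w <= Cmod (w - z) + Cmod z).
    { replace w with ((w - z) + z)%C at 1 by cring; apply Cmod_triangle. }
    change (Cmod (w - z) < INR n - Cmod z) in hw.
    change (Cmod w < INR n); lra.
  - intros z _; exists (S (Z.to_nat (up (Cnorm z)))).
    rewrite S_INR; pose proof (le_INR_up (Cnorm z) _ (Nat.le_refl _)); lra.
  - assert (hb : exists B, 0 <= B /\ forall i, In i l -> INR i <= B).
    { clear hl; induction l as [|i l (B & hB & h)]; [exists 0; split; [lra|intros i []]|].
      pose proof (pos_INR i); exists (B + INR i); split; [lra|].
      intros j [<-|hj]; [lra|specialize (h j hj); lra]. }
    destruct hb as (B & hB & h); exists B; split; [exact hB|].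
    intros z hz; destruct (hl z hz) as (i & hi & hlt); specialize (h i hi); lra.
Qed.

Lemma dini_pprod_cprod (alpha x : nat -> R) (z : Cx) (N : nat) : (forall n, 0 < alpha n) ->
  (forall n, x n = / alpha n ^ 2) -> dini_pprod alpha z N = cprod x N (z * z)%C.
Proof.
  intros ha hx; induction N as [|N IH]; [reflexivity|].
  change (dini_pprod alpha z (S N)) with
    (dini_pprod alpha z N * (1 - (z * z) / Complex.RtoC (alpha N ^ 2)))%C.
  simpl cprod; rewrite IH, hx, RtoC_inv; [reflexivity|].
  pose proof (pow_lt _ 2 (ha N)); lra.
Qed.

Theorem theorem1 (nu : R) (alpha : nat -> R)
  (hnu : nu > -1)
  (hpos : forall n, 0 < alpha n)
  (hinc : forall n, alpha n < alpha (S n))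
  (hzero : forall n, dini nu (RtoC (alpha n)) = C0)
  (hall : forall r, 0 < r -> dini nu (RtoC r) = C0 -> exists n, alpha n = r) :
  exists P : Cx -> Cx,
    (forall K, Ccompact K -> unif_cv_on K (fun N z => dini_pprod alpha z N) P) /\
    (forall z, (z <> C0 \/ 0 <= nu) ->
       dini nu z =
       Cmul (Cdiv (cpow z nu) (RtoC (Rpower 2 nu * Gamma (nu + 1)))) (P z)).
Proof.
  destruct (dini_hadamard nu alpha hnu hpos hinc) as (x & hx & hlim).
  - intros n; apply dini_real_zero; auto.
  - intros r hr h; apply hall; [exact hr|]; now apply dini_real_zero.
  - exists (fun z => cser (dini_coeff nu) (z * z)%C); split.
    + intros K hK eps he; destruct (Ccompact_bounded K hK) as (B & hB & hBK).
      (* The radius is squared because the product is in [z * z]; halving [eps] turns the weak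
         inequality into the strict one. *)
      destruct (hlim (B * B) (eps / 2) ltac:(nra) ltac:(lra)) as [K0 h].
      exists K0; intros N hN z hz; specialize (hBK z hz).
      rewrite (dini_pprod_cprod alpha x z N hpos hx).
      apply Rle_lt_trans with (eps / 2); [|lra].
      apply h; [exact hN|]; rewrite Cmod_mult.
      apply Rmult_le_compat; try apply Cmod_ge_0; exact hBK.
    + intros z hz; exact (dini_cser nu z hnu hz).
Qed.
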